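(* Strong detectability of finite automata can be verified in polynomial time: there is an algorithm that, given a finite automaton $\mathcal{S}$, decides in time polynomial in the size of $\mathcal{S}$ whether $\mathcal{S}$ is strongly detectable.
   Context: A finite automaton is a sextuple $\mathcal{S}=(X,T,X_0,\to,\Sigma,\ell)$ with $X$ a finite set of states, $T$ a finite set of events, $X_0\subset X$ a set of initial states, $\to\subset X\times T\times X$ a transition relation, $\Sigma$ a finite set of outputs (labels), and $\ell:T\to\Sigma\cup\{\epsilon\}$ a labeling function ($\epsilon$ the empty word), extended to finite and infinite event sequences by concatenation. No deadlock-freeness or promptness assumption is made. Write $x\xrightarrow{s}x'$ for $s\in T^+$ if there is a sequence of transitions from $x$ to $x'$ with event sequence $s$. For $\sigma\in\Sigma^*$, $\mathcal{M}(\mathcal{S},\sigma)=\{x\in X\mid \exists x_0\in X_0,\exists s\in T^+: \ell(s)=\sigma,\ x_0\xrightarrow{s}x\}$, with $X_0$ additionally included when $\sigma=\epsilon$. An infinite event sequence $t_1t_2\dots\in T^\omega$ is generated by $\mathcal{S}$ if there are states $x_0,x_1,\dots$ with $x_0\in X_0$ and $(x_i,t_{i+1},x_{i+1})\in\to$ for all $i\in\mathbb{N}$; $\mathcal{L}^\omega(\mathcal{S})$ is the set of $\sigma\in\Sigma^\omega$ that equal $\ell(t_1t_2\dots)$ for some generated $t_1t_2\dots$. $\mathcal{S}$ is strongly detectable if there is a positive integer $k$ such that for every $\sigma\in\mathcal{L}^\omega(\mathcal{S})$, $|\mathcal{M}(\mathcal{S},\sigma')|=1$ for every finite prefix $\sigma'$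 of $\sigma$ with $|\sigma'|>k$. *)

(* Defs.v *)
From HB Require Import structures.
From mathcomp Require Import all_boot all_order all_algebra.
From mathcomp Require Import boolp.

Set Implicit Arguments.
Unset Strict Implicit.
Unset Printing Implicit Defensive.

(* Polynomial time is measured on a unit-cost random access machine with
   registers r0, r1, ... (named statically by the program) and a memory of
   natural numbers addressed indirectly.  The only arithmetic is addition and
   truncated subtraction, so, apart from loading one of the constants of the
   fixed program, a step lengthens the largest value by at most one bit, and t
   steps are simulated by a Turing machine in time polynomial in t and the
   input length: the class of problems decided in polynomial time is the same
   as for Turing machines. *)
Inductive instr : Type :=
| IConst of nat & nat
| IAdd of nat & nat & nat
| ISub of nat & nat & nat
| ILoad of nat & nat
| IStore of nat & nat
| IJumpZ of nat & nat
| IHalt of bool.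

Record config := Config { pc : nat; regs : nat -> nat; mem : nat -> nat }.

Definition upd (f : nat -> nat) (i v : nat) : nat -> nat :=
  fun j => if j == i then v else f j.

Definition exec (i : instr) (c : config) : config + bool :=
  let: Config l r m := c in
  match i with
  | IConst d k => inl (Config l.+1 (upd r d k) m)
  | IAdd d a b => inl (Config l.+1 (upd r d (r a + r b)) m)
  | ISub d a b => inl (Config l.+1 (upd r d (r a - r b)) m)
  | ILoad d a => inl (Config l.+1 (upd r d (m (r a))) m)
  | IStore a b => inl (Config l.+1 r (upd m (r a) (r b)))
  | IJumpZ a k => inl (Config (if r a == 0 then k else l.+1) r m)
  | IHalt b => inr b
  end.

(* [run P t c = Some b] iff P, started in c, halts with answer b within t
   steps (the halting step included); leaving the program text halts with
   answer false. *)
Fixpoint run (P : seq instr) (t : nat) (c : config) : option bool :=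
  if t is t'.+1 then
    match exec (nth (IHalt false) P (pc c)) c with
    | inl c' => run P t' c'
    | inr b => Some b
    end
  else None.

(* A binary input w is stored one bit per cell in mem[0], ..., mem[|w|-1], and
   its length in r0; every other cell and register is 0. *)
Definition init_config (w : seq bool) : config :=
  Config 0 (upd (fun=> 0) 0 (size w)) (fun i => nat_of_bool (nth false w i)).

Definition decidable_in_polytime (A : Type) (enc : A -> seq bool)
    (L : A -> Prop) : Prop :=
  exists (P : seq instr) (p : {poly nat}), forall a : A,
    exists b : bool,
      run P (p.[size (enc a)])%R (init_config (enc a)) = Some b /\
      (b = true <-> L a).

Record automaton : Type := Automaton {
  state : finType;
  event : finType;
  output : finType;
  init : {set state};
  trans : {set state * event * state};
  label : event -> option output   (* None is the empty word *)
}.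

Definition label_word (S : automaton) (s : seq (event S)) : seq (output S) :=
  pmap (@label S) s.

Fixpoint path_to (S : automaton) (x : state S) (s : seq (event S))
    (x' : state S) : Prop :=
  if s is t :: s' then
    exists y : state S, (x, t, y) \in trans S /\ path_to y s' x'
  else x = x'.

Definition estimate (S : automaton) (sigma : seq (output S)) :
    {set state S} :=
  [set x | `[< (exists x0 : state S, exists s : seq (event S),
                  [/\ x0 \in init S, s != [::], label_word s = sigma
                    & path_to x0 s x])
               \/ (sigma = [::] /\ x \in init S) >]].

Definition generated (S : automaton) (t : nat -> event S) : Prop :=
  exists x : nat -> state S,
    x 0 \in init S /\ forall i, (x i, t i, x i.+1) \in trans S.

(* sigma is the infinite word l(t_0) l(t_1) ...: the labels of the finite
   prefixes of t are prefixes of sigma, of unbounded length. *)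
Definition label_omega (S : automaton) (t : nat -> event S)
    (sigma : nat -> output S) : Prop :=
  (forall n, let w := label_word (mkseq t n) in w = mkseq sigma (size w)) /\
  (forall m, exists n, m <= size (label_word (mkseq t n))).

Definition omega_language (S : automaton) (sigma : nat -> output S) : Prop :=
  exists t : nat -> event S, generated t /\ label_omega t sigma.

Definition strongly_detectable (S : automaton) : Prop :=
  exists2 k : nat, 0 < k &
    forall sigma : nat -> output S, omega_language sigma ->
    forall n : nat, k < n -> #|estimate (mkseq sigma n)| = 1.

(* |X|, |T| and |Sigma| in unary, then the bit tables of X_0, of the transition
   relation and of the labeling function (an all-zero row encodes the empty
   word), with X, T and Sigma listed in their enumeration order.  The length,
   |X| + |T| + |Sigma| + 3 + |X| + |X|^2 |T| + |T| |Sigma|, is polynomially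
   related to |X| + |T| + |Sigma| + |->|. *)
Definition encode (S : automaton) : seq bool :=
  let X := enum (state S) in
  let T := enum (event S) in
  let O := enum (output S) in
  rcons (nseq (size X) true) false
  ++ rcons (nseq (size T) true) false
  ++ rcons (nseq (size O) true) false
  ++ [seq x \in init S | x <- X]
  ++ [seq (xt.1, xt.2, y) \in trans S | xt <- [seq (x, t) | x <- X, t <- T], y <- X]
  ++ [seq label t == Some o | t <- T, o <- O].

(* Main.v *)
Require Import Defs.
From mathcomp Require Import all_boot all_order all_algebra.
From mathcomp Require Import boolp zify.

Set Implicit Arguments.
Unset Strict Implicit.
Unset Printing Implicit Defensive.

(* In the self-composition of S, a move of a pair of states is a silent
   transition of one component or a pair of transitions with a common label.
   S fails to be strongly detectable iff some pair of initial states reaches a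
   pair p lying on a cycle with an observable move, p reaches (x, y) with
   x <> y, and x starts a run with infinitely many labels, i.e., (x, x) reaches
   a pair on such a cycle: by pigeonhole this is what arbitrarily long ambiguous
   estimates amount to.  The machine program tabulates reachability between
   pairs of states and then evaluates this condition, a bounded first-order
   formula.  It is compiled from a small language in which all loops run from 0
   to the length of the input, so that its cost is visibly a polynomial. *)

(** * A structured language and its compilation *)

(** Deadlocks and silent cycles are allowed, so a long ambiguous prefix matters only if it extends
    to a run with infinitely many labels. This is required of x alone: y merely explains the finite
    prefix and may be stuck afterwards. Phrasing the extension through the pair (x, x) lets one
    reachability table serve both purposes. The sizes of X, T and Sigma are hidden in unary prefixes
    of the input; bounding all loops by the input length, which the machine provides in register 0,
    avoids having to compute loop bounds, and guards then restrict the loop variables to actual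
    states, events and outputs. *)

Definition reaches (P : seq instr) (c c' : config) (T : nat) : Prop :=
  exists2 t, t <= T & forall k, run P (t + k) c = run P k c'.

Lemma reaches_refl P c T : reaches P c c T.
Proof. by exists 0. Qed.

(** Since [reaches] speaks of every amount [k] of leftover fuel, runs compose by adding their exact
    lengths, while only upper bounds remain visible. *)
Lemma reaches_trans P c1 c2 c3 T1 T2 T :
  reaches P c1 c2 T1 -> reaches P c2 c3 T2 -> T1 + T2 <= T -> reaches P c1 c3 T.
Proof.
move=> [t1 le1 run1] [t2 le2 run2] leT; exists (t1 + t2); first by lia.
by move=> k; rewrite -addnA run1 run2.
Qed.

Lemma reaches_step P c c' c'' T :
  exec (nth (IHalt false) P (pc c)) c = inl c' -> reaches P c' c'' T ->
  reaches P c c'' T.+1.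
Proof.
move=> execE [t le_t run_t]; exists t.+1 => // k.
by rewrite addSn /= execE run_t.
Qed.

Lemma reaches_loop P (J : nat -> config -> Prop) n T :
  (forall i c, i < n -> J i c -> exists2 c', reaches P c c' T & J i.+1 c') ->
  forall c, J 0 c -> exists2 c', reaches P c c' (n * T) & J n c'.
Proof.
move=> body c J0; elim: n body => [|n IHn] body.
  by exists c => //; exact: reaches_refl.
have [i c1 lt_in /(body i c1)|c1 reach1 /(body n c1 (ltnSn n))[c2 reach2 J2]] := IHn.
  by apply; rewrite ltnS ltnW.
by exists c2 => //; apply: reaches_trans reach1 reach2 _; lia.
Qed.

Fixpoint code_at (P : seq instr) (l : nat) (c : seq instr) : Prop :=
  if c is i :: c' then nth (IHalt false) P l = i /\ code_at P l.+1 c' else True.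

Lemma code_at_cat P l c1 c2 :
  code_at P l (c1 ++ c2) -> code_at P l c1 /\ code_at P (l + size c1) c2.
Proof.
elim: c1 l => [|i c1 IHc] l /=; first by rewrite addn0.
by case=> Pl /IHc[]; rewrite addSnnS.
Qed.

Lemma code_at_self P c Q : code_at (P ++ c ++ Q) (size P) c.
Proof.
elim: c P => [//|i c IHc] P /=; split; first by rewrite nth_cat ltnn subnn.
by rewrite -cat_rcons -(size_rcons P i); apply: IHc.
Qed.

(** [Sum v e] adds [e] over all [v] below register 0, the input length. This single loop serves as
    counting, as multiplication and, with nonzero read as true, as bounded existential
    quantification. *)
Inductive expr : Type :=
| Const of nat
| Var of nat
| Add of expr & expr
| Sub of expr & expr
| Read of expr
| If of expr & expr & expr
| Sum of nat & expr.

Fixpoint eval (e : expr) (r m : nat -> nat) : nat :=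
  match e with
  | Const k => k
  | Var v => r v
  | Add e1 e2 => eval e1 r m + eval e2 r m
  | Sub e1 e2 => eval e1 r m - eval e2 r m
  | Read e1 => m (eval e1 r m)
  | If e1 e2 e3 => if eval e1 r m == 0 then eval e3 r m else eval e2 r m
  | Sum v e1 => \sum_(i < r 0) eval e1 (upd r v i) m
  end.

(** Variables lie below [D], leaving the registers from [D] on as scratch space, and no loop rebinds
    register 0, the common loop bound. *)
Fixpoint wf (D : nat) (e : expr) : bool :=
  match e with
  | Const _ => true
  | Var v => v < D
  | Add e1 e2 | Sub e1 e2 => wf D e1 && wf D e2
  | Read e1 => wf D e1
  | If e1 e2 e3 => [&& wf D e1, wf D e2 & wf D e3]
  | Sum v e1 => [&& 0 < v, v < D & wf D e1]
  end.

Lemma eval_ext D e r r' m : 0 < D -> wf D e ->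
  (forall j, j < D -> r j = r' j) -> eval e r m = eval e r' m.
Proof.
move=> D_gt0; elim: e r r' => [k|v|e1 IH1 e2 IH2|e1 IH1 e2 IH2|e1 IH1|
  e1 IH1 e2 IH2 e3 IH3|v e1 IH1] r r' //= wfe eqr.
- exact: eqr.
- by case/andP: wfe => w1 w2; rewrite (IH1 r r') // (IH2 r r').
- by case/andP: wfe => w1 w2; rewrite (IH1 r r') // (IH2 r r').
- by rewrite (IH1 r r').
- by case/and3P: wfe => w1 w2 w3; rewrite (IH1 r r') // (IH2 r r') // (IH3 r r').
- case/and3P: wfe => v_gt0 ltvD w1; rewrite eqr //; apply: eq_bigr => i _.
  by apply: IH1 => // j ltjD; rewrite /upd; case: eqP => // _; apply: eqr.
Qed.

(** The length depends on neither the position nor the target register, so jump targets are known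
    before the code is generated. The 10 is the overhead of [loop_code]. *)
Fixpoint len (e : expr) : nat :=
  match e with
  | Const _ => 1
  | Var _ => 2
  | Add e1 e2 | Sub e1 e2 => len e1 + len e2 + 1
  | Read e1 => len e1 + 1
  | If e1 e2 e3 => len e1 + (1 + (len e2 + (2 + len e3)))
  | Sum _ e1 => 1 + (len e1 + 1 + 10)
  end.

Lemma upd_eq f i v : upd f i v i = v.
Proof. by rewrite /upd eqxx. Qed.

Lemma upd_neq f i v j : j != i -> upd f i v j = f j.
Proof. by rewrite /upd => /negPf->. Qed.

(* Runs the body with v = 0, ..., r0 - 1.  Register d holds 0, d.+1 saves v, and
   d.+2 holds the remaining number of rounds. *)
Definition loop_code (l d v : nat) (body : seq instr) : seq instr :=
  [:: IConst d 0; IAdd d.+1 v d; IConst v 0; ISub d.+2 0 v;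
      IJumpZ d.+2 (l + size body + 9)]
  ++ body
  ++ [:: IConst d.+2 1; IAdd v v d.+2; IConst d.+2 0; IJumpZ d.+2 (l + 3);
         IAdd v d.+1 d].

Lemma loop_code_body P l d v body :
  code_at P l (loop_code l d v body) -> code_at P (l + 5) body.
Proof. by move=> /code_at_cat[_ /code_at_cat[]]. Qed.

(** Among the registers, [I] may depend only on those below [d] other than [v], so the bookkeeping
    of the loop cannot break it. A round costs 2 steps for the test and 4 for the increment and the
    jump back; the final 6 are 3 for the set-up, 2 for the failing test and 1 for restoring [v]. *)
Lemma loop_correct P l d v body T r m
    (I : nat -> (nat -> nat) -> (nat -> nat) -> Prop) :
  0 < v < d -> code_at P l (loop_code l d v body) ->
  (forall i r1 r2 m1, (forall j, j < d -> j != v -> r2 j = r1 j) ->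
    I i r1 m1 -> I i r2 m1) ->
  (forall i r1 m1, I i r1 m1 -> r1 0 = r 0) ->
  (forall i r1 m1, i < r 0 -> I i r1 m1 -> r1 v = i ->
    exists r2 m2, [/\ reaches P (Config (l + 5) r1 m1)
        (Config (l + 5 + size body) r2 m2) T,
      I i.+1 r2 m2, r2 v = i & r2 d = r1 d /\ r2 d.+1 = r1 d.+1]) ->
  I 0 r m ->
  exists r' m', [/\ reaches P (Config l r m) (Config (l + size body + 10) r' m')
      (r 0 * (T + 6) + 6), I (r 0) r' m' & r' v = r v].
Proof.
case/andP=> v_gt0 ltvd /= [P0 [P1 [P2 [P3 [P4]]]]] /code_at_cat[_ /=
  [P5 [P6 [P7 [P8 [P9 _]]]]]].
move=> I_ext I_r0 I_body I0; have l5 : l + 5 = l.+1.+4 by lia.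
(* [J] places the machine at the loop test and adds to [I] the counter in [v], the zero in [d] and
   the saved value of [v] in [d.+1]. *)
pose J i c := exists r1 m1, [/\ c = Config (l + 3) r1 m1, I i r1 m1, r1 v = i,
  r1 d = 0 & r1 d.+1 = r v].
have [||c2 run2] := @reaches_loop P J (r 0) (T + 6) _
    (Config (l + 3) (upd (upd (upd r d 0) d.+1 (r v)) v 0) m).
- move=> i _ lti [r1 [m1 [-> Ii r1v r1d r1d1]]].
  pose r2 := upd r1 d.+2 (r1 0 - r1 v).
  have I2 : I i r2 m1.
    by apply: I_ext Ii => j ltj _; rewrite /r2 upd_neq //; lia.
  have r2v : r2 v = i by rewrite /r2 upd_neq //; lia.
  have [r3 [m3 [run3 I3 r3v [r3d r3d1]]]] := I_body i r2 m1 lti I2 r2v.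
  pose r4 := upd (upd (upd r3 d.+2 1) v i.+1) d.+2 0.
  exists (Config (l + 3) r4 m3).
    apply: (@reaches_trans _ _ (Config (l + 5) r2 m1) _ 2 (T + 4)); last by lia.
      apply: reaches_step; rewrite /= ?addn3 ?P3 //=.
      apply: reaches_step; rewrite /= ?P4 //= upd_eq r1v (I_r0 _ _ _ Ii).
      rewrite ifN; last by lia.
      by rewrite -(I_r0 _ _ _ Ii) -r1v l5; exact: reaches_refl.
    apply: reaches_trans run3 _ _; last exact: leqnn.
    rewrite l5; rewrite -!addSn in P5 P6 P7 P8.
    apply: reaches_step; rewrite /= ?P5 //=.
    apply: reaches_step; rewrite /= ?P6 //=.
    apply: reaches_step; rewrite /= ?P7 //=.
    apply: reaches_step; rewrite /= ?P8 //= !upd_eq upd_neq; last by lia.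
    by rewrite r3v addn1; exact: reaches_refl.
  exists r4, m3; split=> //.
  + apply: I_ext I3 => j ltj nejv; rewrite /r4 !upd_neq //; lia.
  + by rewrite /r4 upd_neq ?upd_eq //; lia.
  + by rewrite /r4 !upd_neq ?r3d /r2 ?upd_neq //; lia.
  + by rewrite /r4 !upd_neq ?r3d1 /r2 ?upd_neq //; lia.
- exists (upd (upd (upd r d 0) d.+1 (r v)) v 0), m; split=> //.
  + by apply: I_ext I0 => j ltj nejv; rewrite !upd_neq //; lia.
  + by rewrite upd_eq.
  + by rewrite 2?upd_neq ?upd_eq //; lia.
  + by rewrite upd_neq ?upd_eq //; lia.
case=> r1 [m1 [Ec2 I1 r1v r1d r1d1]]; rewrite {c2}Ec2 in run2.
have r10 := I_r0 _ _ _ I1.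
exists (upd (upd r1 d.+2 0) v (r v)), m1; split; last by rewrite upd_eq.
  apply: (@reaches_trans _ _ _ _ 3 _ _ _ (reaches_trans run2 _ (leqnn _))).
  - apply: reaches_step; rewrite /= ?P0 //=.
    apply: reaches_step; rewrite /= ?P1 //=.
    apply: reaches_step; rewrite /= ?P2 //=.
    rewrite upd_eq upd_neq ?addn0 ?addn3; last by lia.
    exact: reaches_refl.
  - rewrite addn3; apply: (@reaches_step _ _ _ _ 2); rewrite /= ?P3 //=.
    apply: reaches_step; rewrite /= ?P4 //= upd_eq r1v r10 subnn eqxx.
    have E : l + size body + 9 = (l.+1.+4 + size body).+4 by lia.
    rewrite E; apply: reaches_step; rewrite /=  ?P9 //= !upd_neq; try by lia.
    rewrite r1d r1d1 addn0.
    have -> : l + size body + 10 = (l.+1.+4 + size body).+1.+4 by lia.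
    exact: reaches_refl.
  - lia.
by apply: I_ext I1 => j ltj nejv; rewrite !upd_neq //; lia.
Qed.

(* The value goes to register d; the registers below d end up unchanged. *)
Fixpoint compile (l d : nat) (e : expr) : seq instr :=
  match e with
  | Const k => [:: IConst d k]
  | Var v => [:: IConst d 0; IAdd d v d]
  | Add e1 e2 =>
      compile l d e1 ++ compile (l + len e1) d.+1 e2 ++ [:: IAdd d d d.+1]
  | Sub e1 e2 =>
      compile l d e1 ++ compile (l + len e1) d.+1 e2 ++ [:: ISub d d d.+1]
  | Read e1 => compile l d e1 ++ [:: ILoad d d]
  | If e1 e2 e3 =>
      let l2 := l + len e1 + 1 in
      let l3 := l2 + len e2 + 2 in
      compile l d e1 ++ [:: IJumpZ d l3] ++ compile l2 d e2
      ++ [:: IConst d.+1 0; IJumpZ d.+1 (l3 + len e3)] ++ compile l3 d e3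
  | Sum v e1 =>
      IConst d 0 :: loop_code l.+1 d.+1 v
        (compile (l + 6) d.+4 e1 ++ [:: IAdd d d d.+4])
  end.

Lemma size_compile l d e : size (compile l d e) = len e.
Proof.
elim: e l d => [k|v|e1 IH1 e2 IH2|e1 IH1 e2 IH2|e1 IH1|e1 IH1 e2 IH2 e3 IH3|v e1 IH1]
  l d //=.
- by rewrite !size_cat /= IH1 IH2; lia.
- by rewrite !size_cat /= IH1 IH2; lia.
- by rewrite size_cat IH1.
- by rewrite size_cat IH1 /= size_cat IH2 /= IH3.
- by rewrite !size_cat /= IH1; lia.
Qed.

Fixpoint cost (n : nat) (e : expr) : nat :=
  match e with
  | Const _ => 1
  | Var _ => 2
  | Add e1 e2 | Sub e1 e2 => cost n e1 + cost n e2 + 1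
  | Read e1 => cost n e1 + 1
  | If e1 e2 e3 => cost n e1 + cost n e2 + cost n e3 + 3
  | Sum _ e1 => n * (cost n e1 + 1 + 6) + 7
  end.

(** Scratch registers form a stack: while an intermediate result is held in [d], subexpressions are
    evaluated in higher registers, and the last clause says that they leave it intact. *)
Lemma compile_correct P D e l d r m : 0 < D -> wf D e -> D <= d ->
  code_at P l (compile l d e) ->
  exists r', [/\ reaches P (Config l r m) (Config (l + len e) r' m) (cost (r 0) e),
    r' d = eval e r m & forall j, j < d -> r' j = r j].
Proof.
move=> D_gt0.
elim: e l d r => [k|v|e1 IH1 e2 IH2|e1 IH1 e2 IH2|e1 IH1|e1 IH1 e2 IH2 e3 IH3|v e1 IH1]
  l d r /= wfe leDd.
- case=> Pl _; exists (upd r d k); split; rewrite ?upd_eq //.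
    by apply: reaches_step; rewrite /= ?Pl /= ?addn1 //; exact: reaches_refl.
  by move=> j ltjd; rewrite upd_neq //; lia.
- case=> Pl [Pl1 _]; exists (upd (upd r d 0) d (r v)); split; rewrite ?upd_eq //.
    apply: reaches_step; rewrite /= ?Pl //=.
    apply: reaches_step; rewrite /= ?Pl1 //= upd_eq addn0 upd_neq ?addn2; last by lia.
    exact: reaches_refl.
  by move=> j ltjd; rewrite !upd_neq //; lia.
- case/andP: wfe => w1 w2 /code_at_cat[c1 /code_at_cat[]].
  rewrite !size_compile => c2 /= [Pl _].
  have [r1 [run1 v1 keep1]] := IH1 l d r w1 leDd c1.
  have [r2 [run2 v2 keep2]] := IH2 _ _ r1 w2 (leqW leDd) c2.
  have E2 : eval e2 r1 m = eval e2 r m.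
    by apply: eval_ext w2 _ => // j ltj; apply: keep1; lia.
  rewrite keep1 in run2; last by lia.
  exists (upd r2 d (r2 d + r2 d.+1)); split.
  + apply: reaches_trans run1 _ _; last by rewrite -addnA; exact: leqnn.
    apply: reaches_trans run2 _ _; last exact: leqnn.
    by apply: reaches_step; rewrite /= ?Pl //= !addnA addn1; exact: reaches_refl.
  + by rewrite upd_eq keep2 // v1 v2 E2.
  + by move=> j ltjd; rewrite upd_neq ?keep2 ?keep1; lia.
- case/andP: wfe => w1 w2 /code_at_cat[c1 /code_at_cat[]].
  rewrite !size_compile => c2 /= [Pl _].
  have [r1 [run1 v1 keep1]] := IH1 l d r w1 leDd c1.
  have [r2 [run2 v2 keep2]] := IH2 _ _ r1 w2 (leqW leDd) c2.
  have E2 : eval e2 r1 m = eval e2 r m.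
    by apply: eval_ext w2 _ => // j ltj; apply: keep1; lia.
  rewrite keep1 in run2; last by lia.
  exists (upd r2 d (r2 d - r2 d.+1)); split.
  + apply: reaches_trans run1 _ _; last by rewrite -addnA; exact: leqnn.
    apply: reaches_trans run2 _ _; last exact: leqnn.
    by apply: reaches_step; rewrite /= ?Pl //= !addnA addn1; exact: reaches_refl.
  + by rewrite upd_eq keep2 // v1 v2 E2.
  + by move=> j ltjd; rewrite upd_neq ?keep2 ?keep1; lia.
- move=> /code_at_cat[c1]; rewrite size_compile => -[Pl _].
  have [r1 [run1 v1 keep1]] := IH1 l d r wfe leDd c1.
  exists (upd r1 d (m (r1 d))); split.
  + apply: reaches_trans run1 _ _; last exact: leqnn.
    by apply: reaches_step; rewrite /= ?Pl //= addnA addn1; exact: reaches_refl.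
  + by rewrite upd_eq v1.
  + by move=> j ltjd; rewrite upd_neq ?keep1; lia.
- case/and3P: wfe => w1 w2 w3 /code_at_cat[c1]; rewrite size_compile => /= -[Pl].
  rewrite -addn1 => /code_at_cat[c2]; rewrite size_compile => /= -[Pj [Pj' c3]].
  have [r1 [run1 v1 keep1]] := IH1 l d r w1 leDd c1.
  have E e : wf D e -> eval e r1 m = eval e r m.
    by move=> we; apply: eval_ext we _ => // j ltj; apply: keep1; lia.
  rewrite -addn1 -(addn1 (_ + len e2)) -(addnA (_ + len e2)) in c3.
  have [e1_0|e1_n0] := eqVneq (eval e1 r m) 0.
    have [r3 [run3 v3 keep3]] := IH3 _ _ r1 w3 leDd c3.
    rewrite keep1 in run3; last by lia.
    exists r3; split.
    + apply: (reaches_trans run1 (T2 := (cost (r 0) e3).+1)); last by lia.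
      apply: reaches_step; rewrite /= ?Pl //= v1 e1_0 eqxx.
      have E' : l + len e1 + 1 + len e2 + 2 + len e3 =
                l + (len e1 + (1 + (len e2 + (2 + len e3)))) by lia.
      by rewrite -E'.
    + by rewrite v3 E.
    + by move=> j ltj; rewrite keep3 ?keep1.
  have [r2 [run2 v2 keep2]] := IH2 _ _ r1 w2 leDd c2.
  rewrite keep1 in run2; last by lia.
  exists (upd r2 d.+1 0); split.
  + apply: (reaches_trans run1 (T2 := (cost (r 0) e2 + 2).+1)); last by lia.
    apply: reaches_step; rewrite /= ?Pl //= v1 (negPf e1_n0) -addn1.
    apply: reaches_trans run2 _ (leqnn _).
    apply: reaches_step; rewrite /= ?Pj //=.
    apply: reaches_step; rewrite /= ?Pj' //= upd_eq eqxx.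
    have E' : l + len e1 + 1 + len e2 + 2 + len e3 =
              l + (len e1 + (1 + (len e2 + (2 + len e3)))) by lia.
    by rewrite -E'; exact: reaches_refl.
  + by rewrite upd_neq ?v2 ?E //; lia.
  + by move=> j ltj; rewrite upd_neq ?keep2 ?keep1 //; lia.
- case/and3P: wfe => v_gt0 ltvD w1; rewrite /= -/(loop_code _ _ _ _) => -[Pl cl].
  have ltvd : v < d by lia.
  (* Register [d] accumulates the sum, [d.+1] to [d.+3] serve the loop, and the summand is computed
     in [d.+4]. *)
  pose I i r1 m1 := [/\ m1 = m, r1 d = \sum_(k < i) eval e1 (upd r v k) m
    & forall j, j < d -> j != v -> r1 j = r j].
  have v_bnd : 0 < v < d.+1 by rewrite v_gt0 ltnS ltnW.
  have [||||r' [m' [run' [Em' r'd keep'] r'v]]] :=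
      @loop_correct P l.+1 d.+1 v _ (cost (r 0) e1 + 1) (upd r d 0) m I v_bnd cl.
  + move=> i r1 r2 m1 eqr [-> r1d keep1]; split=> // [|j ltj nej].
      by rewrite eqr // neq_ltn ltvd orbT.
    by rewrite eqr ?keep1 // ltnS ltnW.
  + move=> i r1 m1 [_ _ keep1]; rewrite upd_neq ?keep1 //; lia.
  + move=> i r1 m1 _ [-> r1d keep1] r1v.
    have /code_at_cat[] := loop_code_body cl.
    rewrite size_compile /= addSnnS => c1 [Pb _].
    have [r2 [run2 v2 keep2]] := IH1 _ _ r1 w1 (leq_trans leDd (leq_addl 4 d)) c1.
    exists (upd r2 d (r2 d + r2 d.+4)), m; split.
    * rewrite size_cat size_compile /= !addnS !addn0.
      rewrite keep1 ?upd_neq in run2 *; try by lia.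
      rewrite (_ : l.+2.+4 = l + 6); last by lia.
      apply: reaches_trans run2 _ _; last by rewrite -addn1; exact: leqnn.
      apply: reaches_step; rewrite /= ?Pb //=.
      exact: reaches_refl.
    * split=> // [|j ltj nej]; last first.
        by rewrite upd_neq ?keep2 ?keep1 //; lia.
      rewrite upd_eq big_ord_recr /= keep2 ?r1d ?v2; last by lia.
      congr (_ + _); apply: eval_ext w1 _ => // j ltj.
      rewrite /upd; case: eqP => [->|/eqP nej]; first by [].
      by rewrite keep1 //; lia.
    * by rewrite upd_neq ?keep2 //; lia.
    * by split; rewrite upd_neq ?keep2 //; lia.
  + by split=> // [|j ltj nej]; rewrite ?upd_eq ?big_ord0 // upd_neq //; lia.
  exists r'; rewrite {m'}Em' in run' *; rewrite upd_neq in r'd run'; try by lia.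
  split.
  + apply: (@reaches_trans _ _ (Config l.+1 (upd r d 0) m) _ 1).
    * by apply: reaches_step; rewrite /= ?Pl //=; exact: reaches_refl.
    * rewrite size_cat size_compile /= in run'.
      have -> : l + (1 + (len e1 + 1 + 10)) = l.+1 + (len e1 + 1) + 10 by lia.
      exact: run'.
    * by lia.
  + exact: r'd.
  + move=> j ltj; have [->|nej] := eqVneq j v; last by apply: keep'.
    by rewrite r'v upd_neq //; lia.
Qed.

(** * Commands that write to memory, and whole programs *)

Inductive cmd : Type :=
| Store of expr & expr
| For of nat & cmd.

Fixpoint den (c : cmd) (r m : nat -> nat) : nat -> nat :=
  match c with
  | Store e1 e2 => upd m (eval e1 r m) (eval e2 r m)
  | For v c1 => foldl (fun m1 i => den c1 (upd r v i) m1) m (iota 0 (r 0))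
  end.

Fixpoint wfc (D : nat) (c : cmd) : bool :=
  match c with
  | Store e1 e2 => wf D e1 && wf D e2
  | For v c1 => [&& 0 < v, v < D & wfc D c1]
  end.

Fixpoint lenc (c : cmd) : nat :=
  match c with
  | Store e1 e2 => len e1 + (len e2 + 1)
  | For v c1 => lenc c1 + 10
  end.

Fixpoint compilec (l d : nat) (c : cmd) : seq instr :=
  match c with
  | Store e1 e2 =>
      compile l d e1 ++ compile (l + len e1) d.+1 e2 ++ [:: IStore d d.+1]
  | For v c1 => loop_code l d v (compilec (l + 5) (d + 3) c1)
  end.

Fixpoint costc (n : nat) (c : cmd) : nat :=
  match c with
  | Store e1 e2 => cost n e1 + (cost n e2 + 1)
  | For v c1 => n * (costc n c1 + 6) + 6
  end.

Lemma size_compilec l d c : size (compilec l d c) = lenc c.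
Proof.
elim: c l d => [e1 e2|v c IHc] l d /=.
  by rewrite !size_cat !size_compile.
by rewrite size_cat IHc /=; lia.
Qed.

Lemma den_ext D c r r' m : 0 < D -> wfc D c ->
  (forall j, j < D -> r j = r' j) -> den c r m = den c r' m.
Proof.
move=> D_gt0; elim: c r r' m => [e1 e2|v c IHc] r r' m /=.
  by case/andP=> w1 w2 eqr; rewrite !(@eval_ext D _ r r').
case/and3P=> v_gt0 ltvD wc eqr; rewrite eqr //.
elim: (iota _ _) m => //= i s IHs m; rewrite (IHc _ (upd r' v i)) //.
by move=> j ltj; rewrite /upd; case: eqP => // _; apply: eqr.
Qed.

Lemma compilec_correct P D c l d r m : 0 < D -> wfc D c -> D <= d ->
  code_at P l (compilec l d c) ->
  exists2 r', reaches P (Config l r m) (Config (l + lenc c) r' (den c r m))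
      (costc (r 0) c)
    & forall j, j < d -> r' j = r j.
Proof.
move=> D_gt0; elim: c l d r m => [e1 e2|v c IHc] l d r m /=.
  case/andP=> w1 w2 leDd /code_at_cat[c1 /code_at_cat[]].
  rewrite !size_compile => c2 /= [Pl _].
  have [r1 [run1 v1 keep1]] := compile_correct r m D_gt0 w1 leDd c1.
  have [r2 [run2 v2 keep2]] := compile_correct r1 m D_gt0 w2 (leqW leDd) c2.
  have E2 : eval e2 r1 m = eval e2 r m.
    by apply: eval_ext w2 _ => // j ltj; apply: keep1; lia.
  rewrite keep1 in run2; last by lia.
  exists r2; last by move=> j ltj; rewrite keep2 ?keep1; lia.
  apply: reaches_trans run1 _ (leqnn _); apply: reaches_trans run2 _ (leqnn _).
  apply: reaches_step; rewrite /= ?Pl //= !addnA addn1 keep2 // v1 v2 E2.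
  exact: reaches_refl.
case/and3P=> v_gt0 ltvD wc leDd cl.
pose I i r1 m1 := (forall j, j < d -> j != v -> r1 j = r j) /\
  m1 = foldl (fun m1 i => den c (upd r v i) m1) m (iota 0 i).
have v_bnd : 0 < v < d by lia.
have [||||r' [m' [run' [keep' Em'] r'v]]] :=
    @loop_correct P l d v _ (costc (r 0) c) r m I v_bnd cl.
- move=> i r1 r2 m1 eqr [keep1 ->]; split=> // j ltj nej.
  by rewrite eqr ?keep1.
- by move=> i r1 m1 [keep1 _]; rewrite keep1 //; lia.
- move=> i r1 m1 _ [keep1 Em1] r1v.
  have /(IHc _ _ r1 m1 wc)[|r2 run2 keep2] := loop_code_body cl; first by lia.
  exists r2, (den c r1 m1); split.
  + by rewrite -(keep1 0) ?size_compilec //; lia.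
  + split=> [j ltj nej|]; first by rewrite keep2 ?keep1 //; lia.
    rewrite -addn1 iotaD foldl_cat /= -Em1; apply: den_ext wc _ => // j ltj.
    rewrite /upd; case: eqP => [->|/eqP nej]; first by [].
    by rewrite keep1 //; lia.
  + by rewrite keep2 //; lia.
  + by rewrite !keep2 //; lia.
- by split.
exists r'.
  by rewrite -Em' addnA -(size_compilec (l + 5) (d + 3) c).
move=> j ltj; have [->|nej] := eqVneq j v; first by [].
exact: keep'.
Qed.

(** The answer is [true] when [e] evaluates to 0: [e] is meant to express the failure of the
    property to be decided. *)
Definition program (D : nat) (c : cmd) (e : expr) : seq instr :=
  compilec 0 D c ++ compile (lenc c) D e
  ++ [:: IJumpZ D (lenc c + len e + 2); IHalt false; IHalt true].

Lemma program_correct D c e w : 0 < D -> wfc D c -> wf D e ->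
  let n := size w in
  let s := init_config w in
  run (program D c e) (costc n c + cost n e + 2) s =
    Some (eval e (regs s) (den c (regs s) (Defs.mem s)) == 0).
Proof.
move=> D_gt0 wc we n s; set P := program D c e.
have [c1 /code_at_cat[]] : code_at P 0 (compilec 0 D c) /\
    code_at P (lenc c) (compile (lenc c) D e
      ++ [:: IJumpZ D (lenc c + len e + 2); IHalt false; IHalt true]).
  have := @code_at_self [::] P [::]; rewrite cats0 => /code_at_cat.
  by rewrite size_compilec; case.
rewrite size_compile => c2 /= [P0 [P1 [P2 _]]].
have [r1 run1 keep1] := compilec_correct (regs s) (Defs.mem s) D_gt0 wc (leqnn D) c1.
set m := den c _ _ in run1 *.
have [r2 [run2 v2 keep2]] := compile_correct r1 m D_gt0 we (leqnn D) c2.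
have [] := reaches_trans run1 run2 (leqnn _).
rewrite !keep1 // (_ : regs s 0 = n) // => t le_t run_t.
(* The exact running time [t] of the compiled parts is only bounded; at least two units of fuel
   remain for the jump and the halt. *)
have -> : costc n c + cost n e + 2 = t + (costc n c + cost n e - t).+2 by lia.
rewrite [s](_ : _ = Config 0 (regs s) (Defs.mem s)) // run_t.
rewrite [run _ _ _]/= P0 /= v2 (eval_ext (r' := regs s) _ D_gt0 we) //.
by case: eqP => _ /=; rewrite ?addn2 ?P1 ?P2.
Qed.

(** * Costs are polynomials in the input length *)

Definition is_poly (f : nat -> nat) : Prop :=
  exists p : {poly nat}, forall n, f n = (p.[n])%R.

Lemma is_poly_const k : is_poly (fun=> k).
Proof. by exists k%:P%R => n; rewrite hornerC. Qed.

Lemma is_poly_id : is_poly id.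
Proof. by exists 'X%R => n; rewrite hornerX. Qed.

Lemma is_polyD f g : is_poly f -> is_poly g -> is_poly (fun n => f n + g n).
Proof. by move=> [p fE] [q gE]; exists (p + q)%R => n; rewrite hornerD -fE -gE. Qed.

Lemma is_polyM f g : is_poly f -> is_poly g -> is_poly (fun n => f n * g n).
Proof. by move=> [p fE] [q gE]; exists (p * q)%R => n; rewrite hornerM -fE -gE. Qed.

Lemma is_poly_cost e : is_poly (cost^~ e).
Proof.
by elim: e => *; do ?[apply: is_polyD | apply: is_polyM | exact: is_poly_id
  | exact: is_poly_const].
Qed.

Lemma is_poly_costc c : is_poly (costc^~ c).
Proof.
by elim: c => *; do ?[exact: is_poly_cost | apply: is_polyD | apply: is_polyM
  | exact: is_poly_id | exact: is_poly_const].
Qed.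

(** * Ambiguity in the self-composition *)

Section SelfComposition.
Variable S : automaton.
Local Notation X := (state S).
Implicit Types (x y z : X) (p q : X * X) (s : seq (event S)).

Definition silent (x y : X) : bool :=
  [exists t, ((x, t, y) \in trans S) && (@label S t == None)].

Definition joint (p q : X * X) : bool :=
  [exists t1, exists t2, exists o, [&& (p.1, t1, q.1) \in trans S,
    (p.2, t2, q.2) \in trans S, @label S t1 == Some o & @label S t2 == Some o]].

Definition move (p q : X * X) : bool :=
  [|| silent p.1 q.1 && (p.2 == q.2), (p.1 == q.1) && silent p.2 q.2 | joint p q].

Definition pumping (p : X * X) : bool :=
  [exists a, exists b, [&& connect move p a, joint a b & connect move b p]].

Definition ambiguous : bool :=
  [exists p0, exists p, exists q, exists r,
   [&& p0.1 \in init S, p0.2 \in init S, connect move p0 p, pumping p,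
       connect move p r, r.1 != r.2, connect move (r.1, r.1) q & pumping q]].

(** The word-level view of a path in the self-composition: [n] common labels, with no interleaving
    of the silent events prescribed. *)
Definition joint_run (n : nat) (p q : X * X) : Prop :=
  exists s1 s2, [/\ size (label_word s1) = n, label_word s1 = label_word s2,
    path_to p.1 s1 q.1 & path_to p.2 s2 q.2].

Lemma path_to_cat x s1 s2 z :
  path_to x (s1 ++ s2) z <-> exists2 y, path_to x s1 y & path_to y s2 z.
Proof.
elim: s1 x => [|t s1 IHs] x /=; first by split=> [xz|[y ->]]; first exists x.
split=> [[y [xy /IHs[y' yy' y'z]]]|[y' [y [xy yy'] y'z]]].
  by exists y' => //; exists y.
by exists y; split=> //; apply/IHs; exists y'.
Qed.

Lemma label_word_cat s1 s2 :
  label_word (s1 ++ s2) = label_word s1 ++ label_word s2.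
Proof. exact: pmap_cat. Qed.

Lemma joint_run0 p : joint_run 0 p p.
Proof. by exists [::], [::]; split. Qed.

Lemma joint_run_trans n1 n2 p q r :
  joint_run n1 p q -> joint_run n2 q r -> joint_run (n1 + n2) p r.
Proof.
move=> [s1 [s2 [<- E1 p1 p2]]] [u1 [u2 [<- E2 q1 q2]]].
exists (s1 ++ u1), (s2 ++ u2); split; rewrite ?label_word_cat ?size_cat ?E1 ?E2 //.
- by apply/path_to_cat; exists q.1.
- by apply/path_to_cat; exists q.2.
Qed.

Lemma joint_run_mul n k p : joint_run n p p -> joint_run (k * n) p p.
Proof.
move=> run_p; elim: k => [|k IHk]; first exact: joint_run0.
by rewrite mulSn; apply: joint_run_trans IHk.
Qed.

Lemma joint_joint_run p q : joint p q -> joint_run 1 p q.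
Proof.
move=> /existsP[t1 /existsP[t2 /existsP[o /and4P[tr1 tr2 /eqP l1 /eqP l2]]]].
by exists [:: t1], [:: t2]; rewrite /label_word /= l1 l2; split=> //;
  [exists q.1 | exists q.2].
Qed.

Lemma connect_joint_run p q : connect move p q -> exists n, joint_run n p q.
Proof.
case/connectP=> s path_s ->; elim: s p path_s => [|a s IHs] p /=.
  by exists 0; exact: joint_run0.
case/andP=> pa /IHs[n run_a]; case/or3P: pa.
- case/andP=> /existsP[t /andP[tr /eqP l0]] /eqP E.
  exists (0 + n); apply: joint_run_trans run_a.
  exists [:: t], [::]; rewrite /label_word /= l0; split=> //; by exists a.1.
- case/andP=> /eqP E /existsP[t /andP[tr /eqP l0]].
  exists (0 + n); apply: joint_run_trans run_a.
  exists [::], [:: t]; rewrite /label_word /= l0; split=> //; by exists a.2.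
- by move/joint_joint_run => run_p; exists (1 + n); apply: joint_run_trans run_a.
Qed.

(* Synchronizes two runs with the same labels: silent moves are made one side at
   a time, and the first observable move is exposed when there is one. *)
Lemma joint_run_split n p r : joint_run n p r ->
  if n is n'.+1 then
    exists a b : X * X, [/\ connect move p a, joint a b & joint_run n' b r]
  else is_true (connect move p r).
Proof.
case=> s1 [s2 []]; case: p r => [x y] [x' y'] /=.
(* A silent move consumes an event of one word only, hence an induction on the total length. *)
have [k lek] := ubnP (size s1 + size s2).
elim: k x y s1 s2 lek => // k IHk x y s1 s2 lek size_s E p1 p2.
case: s1 lek size_s E p1 => [|t1 s1] lek.
  case: s2 lek p2 => [|t2 s2] lek /=; first by move=> -> <- _ ->.
  case=> y1 [tr p2]; rewrite /label_word /=; case l2: (label t2) => [o|] //= n0 E p1.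
  have mv : move (x, y) (x, y1).
    by apply/or3P/Or32; rewrite /= eqxx; apply/existsP; exists t2; rewrite tr l2 /=.
  have := IHk x y1 [::] s2 _ n0 E p1 p2; rewrite -n0 => H.
  by apply: connect_trans (connect1 mv) _; apply: H; move: lek => /=; lia.
move=> /=; rewrite {1 2}/label_word /=;
case l1: (label t1) => [o|] /= size_s E; last first.
  case=> x1 [tr p1].
  have mv : move (x, y) (x1, y).
    by apply/or3P/Or31; rewrite /= eqxx andbT; apply/existsP; exists t1; rewrite tr l1 /=.
  have := IHk x1 y s1 s2 _ size_s E p1 p2; case: (n) => [|n'] H.
    by apply: connect_trans (connect1 mv) _; apply: H; move: lek => /=; lia.
  case: H => [|a [b [con jt run_b]]]; first by move: lek => /=; lia.
  by exists a, b; split=> //; apply: connect_trans (connect1 mv) con.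
move=> [x1 [tr1 p1]].
case: s2 lek p2 E => [|t2 s2] lek //= [y1 [tr2 p2]]; rewrite {2}/label_word /=.
case l2: (label t2) => [o'|] /= E; last first.
  have mv : move (x, y) (x, y1).
    by apply/or3P/Or32; rewrite /= eqxx; apply/existsP; exists t2; rewrite tr2 l2 /=.
  have := IHk x y1 (t1 :: s1) s2; rewrite /= {1 2}/label_word /= l1 /= => /(_ _ size_s E).
  rewrite -size_s /= => H; case: H => //; first by move: lek => /=; lia.
    by exists x1.
  move=> a [b [con jt run_b]].
  by exists a, b; split=> //; apply: connect_trans (connect1 mv) con.
case: E => Eo E; rewrite -size_s; exists (x, y), (x1, y1); split=> //.
  apply/existsP; exists t1; apply/existsP; exists t2; apply/existsP; exists o.
  by rewrite /= tr1 tr2 l1 l2 Eo !eqxx.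
by exists s1, s2.
Qed.

Lemma joint_run_connect n p r : joint_run n p r -> connect move p r.
Proof.
elim: n p => [|n IHn] p /joint_run_split //= [a [b [con jt /IHn con']]].
apply: connect_trans con _; apply: connect_trans con'; apply: connect1.
by rewrite /move jt !orbT.
Qed.

(** [n] counts labels, not events: a purely silent cycle does not pump. From right to left,
    splitting the run at its first label exposes the joint move of the cycle. *)
Lemma pumpingP p : reflect (exists2 n, 0 < n & joint_run n p p) (pumping p).
Proof.
apply: (iffP existsP) => [[a /existsP[b /and3P[pa ab bp]]]|[[//|n] _]].
  have [n1 run1] := connect_joint_run pa; have [n2 run2] := connect_joint_run bp.
  exists (n1 + (1 + n2)); first by lia.
  exact: joint_run_trans run1 (joint_run_trans (joint_joint_run ab) run2).
move=> /joint_run_split[a [b [pa ab /joint_run_connect bp]]].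
by exists a; apply/existsP; exists b; rewrite pa ab bp.
Qed.

(** Pigeonhole on [p] and the pairs right after each observable move: these are [n.+1] pairs, so one
    recurs, and at least one label is produced between its two occurrences. *)
Lemma joint_run_pumping n p r : #|{: X * X}| <= n -> joint_run n p r ->
  exists q, [/\ connect move p q, pumping q & connect move q r].
Proof.
(* [advance] asks for at least one label; being transitive, it gives a pumping loop between two
   equal entries of a chain. *)
move=> le_n; pose advance a b := `[< exists2 k, 0 < k & joint_run k a b >].
have advance_trans : transitive advance.
  move=> b a c /asboolP[k k_gt0 run_ab] /asboolP[k' _ run_bc]; apply/asboolP.
  by exists (k + k'); [lia | exact: joint_run_trans run_ab run_bc].
have advance_connect a b : advance a b -> connect move a b.
  by move=> /asboolP[k _ /joint_run_connect].
(* The run is cut after each joint move; what is silent after the last cut goes into the final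
   [connect]. *)
have unroll : forall k a, joint_run k a r -> exists cs : seq (X * X), [/\ size cs = k,
    path advance a cs & connect move (last a cs) r].
  elim=> [|k IHk] a /joint_run_split /=; first by move=> con; exists [::].
  move=> [b [c [ab bc /IHk[s [size_s path_s con]]]]].
  exists (c :: s); rewrite /= size_s path_s andbT; split=> //; apply/asboolP.
  have [k1 run1] := connect_joint_run ab; exists (k1 + 1); first by lia.
  exact: joint_run_trans run1 (joint_joint_run bc).
move=> /unroll[s [size_s path_s con]].
have : ~~ uniq (p :: s).
  apply/negP => /card_uniqP /= card_s.
  by have := leq_trans (max_card (mem (p :: s))) le_n; rewrite card_s size_s ltnn.
case/(uniqPn p) => i [j [ltij ltj Eij]].
have lti := ltn_trans ltij ltj.
have sorted_con : sorted (connect move) (p :: s) by apply: sub_path path_s.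
have nth_con := sorted_leq_nth (@connect_trans _ move) (@connect0 _ move) p sorted_con.
exists (nth p (p :: s) i); split.
- exact: (nth_con 0 i).
- have sorted_adv : sorted advance (p :: s) by [].
  have := sorted_ltn_nth advance_trans p sorted_adv i j lti ltj ltij.
  by rewrite -Eij => /asboolP/pumpingP.
- apply: connect_trans con; rewrite (last_nth p).
  by apply: (nth_con i (size s) lti (ltnSn _)); rewrite -ltnS; exact: lti.
Qed.

(** * Infinite runs with infinitely many labels *)

Definition inf_run (x : X) (t : nat -> event S) : Prop :=
  exists2 xs : nat -> X, xs 0 = x & forall i, (xs i, t i, xs i.+1) \in trans S.

Definition observable (t : nat -> event S) : Prop :=
  forall m, exists n, m <= size (label_word (mkseq t n)).

Definition live (x : X) : Prop := exists2 t, inf_run x t & observable t.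

Lemma mkseqD (T : Type) (f : nat -> T) n k :
  mkseq f (n + k) = mkseq f n ++ mkseq (fun i => f (n + i)) k.
Proof. by rewrite /mkseq iotaD map_cat add0n -{2}[n]addn0 iotaDl -map_comp. Qed.

Lemma observable_shift t n : observable t -> observable (fun i => t (n + i)).
Proof.
move=> obs m; have [k le_k] := obs (size (label_word (mkseq t n)) + m); exists k.
rewrite -(leq_add2l (size (label_word (mkseq t n)))) -size_cat -label_word_cat -mkseqD.
by apply: leq_trans le_k _; rewrite addnC mkseqD label_word_cat size_cat leq_addr.
Qed.

Lemma observable_unshift t n : observable (fun i => t (n + i)) -> observable t.
Proof.
move=> obs m; have [k le_k] := obs m; exists (n + k).
by rewrite mkseqD label_word_cat size_cat (leq_trans le_k) ?leq_addl.
Qed.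

Lemma inf_run_path xs t : (forall i, (xs i, t i, xs i.+1) \in trans S) ->
  forall n, path_to (xs 0) (mkseq t n) (xs n).
Proof.
move=> step n.
suff path_k k : path_to (xs k) (map t (iota k n)) (xs (k + n)) by exact: (path_k 0).
elim: n k => [|n IHn] k /=; first by rewrite addn0.
by exists (xs k.+1); rewrite addnS -addSn.
Qed.

Lemma path_to_states x s y : path_to x s y ->
  exists ys : nat -> X, [/\ ys 0 = x, ys (size s) = y
    & forall t0 i, i < size s -> (ys i, nth t0 s i, ys i.+1) \in trans S].
Proof.
elim: s x => [|t s IHs] x /=; first by move=> <-; exists (fun=> x).
move=> [z [xz /IHs[ys [ys0 ysn step]]]].
exists (fun i => if i is i'.+1 then ys i' else x); split=> // t0 [|i] /=.
  by rewrite ys0.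
exact: step.
Qed.

Lemma inf_run_prepend x s y t : path_to x s y -> inf_run y t ->
  exists t', [/\ inf_run x t', mkseq t' (size s) = s
    & (fun i => t' (size s + i)) =1 t].
Proof.
elim: s x => [|a s IHs] x /=; first by move=> -> run_t; exists t.
move=> [z [xz /IHs{}IHs]] /IHs[t' [[xs xs0 step] t's t't]].
exists (fun i => if i is i'.+1 then t' i' else a); split.
- exists (fun i => if i is i'.+1 then xs i' else x) => // -[|i] /=; last exact: step.
  by rewrite xs0.
- by rewrite -[(size s).+1]add1n mkseqD /=; congr cons; rewrite -{2}t's.
- by move=> i; rewrite addSn; exact: t't.
Qed.

Lemma inf_run_cycle x s : path_to x s x -> 0 < size s ->
  exists2 t, inf_run x t & forall k, mkseq t (k * size s) = flatten (nseq k s).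
Proof.
case: s => // a s /path_to_states[ys [ys0 ysn step]] _.
set v := a :: s in ysn step *; exists (fun i => nth a v (i %% size v)).
  exists (fun i => ys (i %% size v)); first by rewrite mod0n.
  move=> i; have lti : i %% size v < size v by rewrite ltn_mod.
  have := step a _ lti; rewrite modnS; case: ifP => // dvd.
  (* At the wrap-around the index returns to 0, and [ys 0 = x = ys (size v)] closes the cycle. *)
  suff -> : (i %% size v).+1 = size v by rewrite ysn ys0.
  move: dvd; rewrite {1}(divn_eq i (size v)) -addnS dvdn_addr ?dvdn_mull //.
  by move/dvdn_leq => /(_ isT) le_v; apply/eqP; rewrite eqn_leq lti.
elim=> [//|k IHk].
rewrite mulSn mkseqD (_ : flatten _ = v ++ flatten (nseq k v)) //; congr (_ ++ _).
  rewrite -[RHS](mkseq_nth a); apply/eq_in_map => i; rewrite mem_iota => /andP[_ lti].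
  by rewrite modn_small.
by rewrite -[RHS]IHk; apply: eq_mkseq => i; rewrite modnDl.
Qed.

(** From left to right, the run is paired with itself and the pigeonhole applies. Conversely [q] may
    be off the diagonal: the first components of the two joint runs already form a path and a cycle
    carrying a label. *)
Lemma liveP x :
  live x <-> exists q, connect move (x, x) q /\ pumping q.
Proof.
split=> [[t [xs xs0 step] obs]|[q [/connect_joint_run[n [s1 [_ [_ _ p1 _]]]]]]].
  have [n le_n] := obs #|{: X * X}|.
  have run_t : joint_run (size (label_word (mkseq t n))) (x, x) (xs n, xs n).
    by exists (mkseq t n), (mkseq t n); split; rewrite //= -xs0; exact: inf_run_path.
  by have [q [con pq _]] := joint_run_pumping le_n run_t; exists q.
case/pumpingP=> k k_gt0 [s [_ [size_s _ ps _]]].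
have s_gt0 : 0 < size s by case: (s) size_s => //= k0; rewrite -k0 in k_gt0.
have [t run_t cyc_t] := inf_run_cycle ps s_gt0.
have [t' [run_t' _ t't]] := inf_run_prepend p1 run_t.
exists t' => //; apply: (@observable_unshift _ (size s1)) => m.
exists (m * size s); rewrite (eq_mkseq t't) cyc_t.
elim: m => //= m IHm; rewrite label_word_cat size_cat; lia.
Qed.

(** [sigma m] is read off a prefix of [t] with at least [m.+1] labels; prefixes agree where they
    overlap, so it does not matter which one [N] picks. *)
Lemma observable_omega t : observable t -> exists sigma, label_omega t sigma.
Proof.
move=> obs; have [N leN] := choice obs.
have o0 : output S by have := leN 1; case: (label_word _).
exists (fun m => nth o0 (label_word (mkseq t (N m.+1))) m); split=> //= n.
apply: (@eq_from_nth _ o0) => [|i lti]; first by rewrite size_mkseq.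
have nth_lw n1 n2 : n1 <= n2 -> i < size (label_word (mkseq t n1)) ->
    nth o0 (label_word (mkseq t n2)) i = nth o0 (label_word (mkseq t n1)) i.
  by move=> /subnKC <- lti1; rewrite mkseqD label_word_cat nth_cat lti1.
rewrite nth_mkseq //; case: (leqP n (N i.+1)) => [le_n|/ltnW le_n].
  by rewrite (nth_lw n (N i.+1)).
by rewrite (nth_lw (N i.+1) n).
Qed.

(** An event adds at most one label, so the shortest prefix with at least [n] labels has exactly
    [n]. *)
Lemma label_omega_prefix (t : nat -> event S) sigma n : label_omega t sigma ->
  exists k, label_word (mkseq t k) = mkseq sigma n.
Proof.
move=> [pre /(_ n) exk]; case: (ex_minnP exk) => k le_k min_k.
exists k; rewrite pre; congr mkseq; apply/eqP; rewrite eqn_leq le_k andbT.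
case: k le_k min_k => // k _ min_k.
have : size (label_word (mkseq t k)) < n by rewrite ltnNge; apply/negP=> /min_k; lia.
rewrite -[k.+1]addn1 mkseqD label_word_cat size_cat /= {2}/label_word /=.
by case: (label _) => [o|] /=; rewrite ?addn0 ?addn1 //; apply: ltnW.
Qed.

(** * Estimates and strong detectability *)

Lemma mem_estimate_run x0 x s : x0 \in init S -> path_to x0 s x ->
  x \in estimate (label_word s).
Proof.
move=> init_x0 ps; rewrite inE; apply/asboolP; case: s ps => [<-|t s ps]; first by right.
by left; exists x0, (t :: s).
Qed.

(** The clause of [estimate] for the empty word accounts for the empty event sequence; with the
    converse just proved, an estimate consists of the ends of possibly empty runs. *)
Lemma mem_estimateP x sigma : x \in estimate sigma ->
  exists x0 s, [/\ x0 \in init S, label_word s = sigma & path_to x0 s x].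
Proof.
rewrite inE => /asboolP[[x0 [s [init_x0 _ lw ps]]]|[-> init_x]]; first by exists x0, s.
by exists x, [::].
Qed.

Lemma strongly_detectableP : strongly_detectable S <-> ~~ ambiguous.
Proof.
split=> [[k k_gt0 det]|unamb].
  apply/negP => /existsP[p0 /existsP[p /existsP[q /existsP[r]]]].
  case/and5P=> init1 init2 /connect_joint_run[n1 run1] /pumpingP[n n_gt0 run_p].
  case/and4P=> /connect_joint_run[n2 run2] ne_r con_q pump_q.
  have /liveP[t run_t obs_t] : exists q, connect move (r.1, r.1) q /\ pumping q.
    by exists q.
  (* [k.+1] turns around the cycle at [p] produce more than [k] labels before the ambiguity at
     [r]. *)
  have := joint_run_trans run1 (joint_run_trans (joint_run_mul k.+1 run_p) run2).
  set N := n1 + _; have ltkN : k < N by nia.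
  move=> [s1 [s2 [size_s E ps1 ps2]]].
  have [t' [run_t' t's t't]] := inf_run_prepend ps1 run_t.
  have obs_t' : observable t'.
    apply: (@observable_unshift _ (size s1)) => m; have [i le_i] := obs_t m.
    by exists i; rewrite (eq_mkseq t't).
  have [sigma om] := observable_omega obs_t'.
  have lw_s1 : label_word s1 = mkseq sigma N by rewrite -t's om.1 t's size_s.
  have /(_ N ltkN)/eqP/cards1P[z Ez] : forall n, k < n -> #|estimate (mkseq sigma n)| = 1.
    apply: det; exists t'; split=> //.
    by case: run_t' => xs xs0 step; exists xs; rewrite xs0.
  have := mem_estimate_run init1 ps1; have := mem_estimate_run init2 ps2.
  by rewrite -E lw_s1 Ez !inE => /eqP E2 /eqP E1; rewrite E1 E2 eqxx in ne_r.
(* As many labels as there are pairs trigger the pigeonhole; the successor makes the bound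
   positive. *)
exists #|{: X * X}|.+1 => // sigma [t [[xs [init_x step]] om]] n ltn.
have [k lw_k] := label_omega_prefix n om.
have pk := inf_run_path step k.
(* The run itself puts [xs k] in the estimate, so only a second element [y] has to be excluded. *)
apply/eqP/cards1P; exists (xs k); apply/setP=> y; rewrite inE.
apply/idP/eqP => [|->]; last by rewrite -lw_k; exact: mem_estimate_run pk.
case/mem_estimateP=> y0 [s [init_y0 lw_s ps]]; apply/eqP; apply: contraNT unamb => ne_y.
have [||p [con1 pump_p con2]] := @joint_run_pumping n (xs 0, y0) (xs k, y).
- lia.
- by exists (mkseq t k), s; split; rewrite ?lw_k ?lw_s ?size_mkseq.
have /liveP[q [con_q pump_q]] : live (xs k).
  exists (fun i => t (k + i)); last by apply: observable_shift; case: om.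
  by exists (fun i => xs (k + i)) => [|i]; rewrite ?addn0 ?addnS.
apply/existsP; exists (xs 0, y0); apply/existsP; exists p; apply/existsP; exists q.
by apply/existsP; exists (xs k, y); rewrite /= init_x init_y0 con1 pump_p con2 eq_sym
  ne_y con_q.
Qed.
End SelfComposition.

(** * Evaluating formulas over the encoded automaton *)

Definition holds (e : expr) (r m : nat -> nat) : bool := eval e r m != 0.

Definition Not e := If e (Const 0) (Const 1).
Definition And e1 e2 := If e1 e2 (Const 0).
Definition Or e1 e2 := If e1 (Const 1) e2.
Definition Lt e1 e2 := Sub e2 e1.
Definition Eq e1 e2 := Not (Add (Sub e1 e2) (Sub e2 e1)).
(** The loop runs up to register 0; the guard cuts it down to the ranks of an enumeration. *)
Definition ExBelow v e1 e2 := Sum v (And (Lt (Var v) e1) e2).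
(** A product as a sum in which [e1] terms equal [e2] and the others 0, provided that neither
    operand depends on register [v]. *)
Definition Mul v e1 e2 := Sum v (If (Lt (Var v) e1) e2 (Const 0)).

Lemma holds_Not e r m : holds (Not e) r m = ~~ holds e r m.
Proof. by rewrite /holds /=; case: ifP. Qed.

Lemma eval_Add e1 e2 r m : eval (Add e1 e2) r m = eval e1 r m + eval e2 r m.
Proof. by []. Qed.

Lemma eval_Not e r m : eval (Not e) r m = if ~~ holds e r m then 1 else 0.
Proof. by rewrite /holds /=; case: ifP. Qed.

Lemma holds_And e1 e2 r m : holds (And e1 e2) r m = holds e1 r m && holds e2 r m.
Proof. by rewrite /holds /=; case: ifP. Qed.

Lemma holds_Or e1 e2 r m : holds (Or e1 e2) r m = holds e1 r m || holds e2 r m.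
Proof. by rewrite /holds /=; case: ifP. Qed.

Lemma holds_Lt e1 e2 r m : holds (Lt e1 e2) r m = (eval e1 r m < eval e2 r m).
Proof. by rewrite /holds /= subn_eq0 ltnNge. Qed.

Lemma holds_Eq e1 e2 r m : holds (Eq e1 e2) r m = (eval e1 r m == eval e2 r m).
Proof. by rewrite holds_Not /holds /= negbK addn_eq0 !subn_eq0 -eqn_leq. Qed.

Lemma holds_Sum v e r m :
  holds (Sum v e) r m = [exists i : 'I_(r 0), holds e (upd r v i) m].
Proof. by rewrite /holds /= sum_nat_eq0 negb_forall. Qed.

Lemma holds_ExBelow (U : finType) v e1 e2 r m : #|U| <= r 0 ->
  (forall i, eval e1 (upd r v i) m = #|U|) ->
  holds (ExBelow v e1 e2) r m =
    [exists x : U, holds e2 (upd r v (enum_rank x)) m].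
Proof.
move=> leU E1; rewrite holds_Sum; apply/existsP/existsP => [[i]|[x e2x]].
  rewrite holds_And holds_Lt E1 /= upd_eq => /andP[ltiU e2i].
  by exists (enum_val (Ordinal ltiU)); rewrite enum_valK.
exists (widen_ord leU (enum_rank x)).
by rewrite holds_And holds_Lt E1 /= upd_eq ltn_ord.
Qed.

Lemma sum_nat_widen n k c : k <= n -> \sum_(i < n) (if i < k then c else 0) = k * c.
Proof.
move=> lekn; rewrite -big_mkcond -(big_ord_widen n (fun=> c)) //.
by rewrite sum_nat_const card_ord.
Qed.

Lemma eval_Mul v e1 e2 r m k1 k2 : k1 <= r 0 ->
  (forall i, eval e1 (upd r v i) m = k1) -> (forall i, eval e2 (upd r v i) m = k2) ->
  eval (Mul v e1 e2) r m = k1 * k2.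
Proof.
move=> lek E1 E2; rewrite -(sum_nat_widen k2 lek) [LHS]/=; apply: eq_bigr => i _.
by rewrite E1 E2 upd_eq subn_eq0 ltnNge; case: leqP.
Qed.

(** * Bit positions in the encoding *)

Lemma nth_unary n (u : seq bool) j : j <= n ->
  nth false (rcons (nseq n true) false ++ u) j = (j < n).
Proof.
move=> lejn; rewrite nth_cat size_rcons size_nseq ltnS lejn nth_rcons size_nseq nth_nseq.
by case: (j < n); rewrite ?if_same.
Qed.

Lemma nth_unary_skip n (u : seq bool) j :
  nth false (rcons (nseq n true) false ++ u) (n + j).+1 = nth false u j.
Proof.
rewrite nth_cat size_rcons size_nseq ltnNge ltnS leq_addr /=; congr nth; lia.
Qed.

Lemma nth_allpairs (U V W : Type) (f : U -> V -> W) (s : seq U) (t : seq V)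
    x0 y0 z0 i j : i < size s -> j < size t ->
  nth z0 [seq f x y | x <- s, y <- t] (size t * i + j) = f (nth x0 s i) (nth y0 t j).
Proof.
elim: s i => // x s IHs [|i] lti ltj /=; rewrite nth_cat size_map.
  by rewrite muln0 ltj (nth_map y0).
by rewrite ifN ?mulnS -?addnA; [rewrite addKn IHs | lia].
Qed.

Lemma ltn_mulD a b i j : i < a -> j < b -> b * i + j < a * b.
Proof. by move=> lti ltj; nia. Qed.

Section Formulas.
Variable S : automaton.
Local Notation X := (state S).
Local Notation w := (encode S).
Local Notation B := (size (encode S)).
Local Notation nX := #|state S|.
Local Notation nT := #|event S|.
Local Notation nO := #|output S|.

Lemma size_encode :
  B = nX + nT + nO + 3 + nX + nX * (nX * nT) + nO * nT.
Proof.
rewrite /encode !size_cat !size_rcons !size_nseq size_map !size_allpairs -!cardE.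
by move: #|X| #|event S| #|output S| => a b c; lia.
Qed.

Lemma nth_encode_states j : j <= nX -> nth false w j = (j < nX).
Proof. by move=> ?; rewrite /encode -!cardE nth_unary. Qed.

Lemma nth_encode_events j : j <= nT -> nth false w (nX + 1 + j) = (j < nT).
Proof.
by move=> ?; rewrite /encode -!cardE addn1 addSn nth_unary_skip nth_unary.
Qed.

Lemma nth_encode_outputs j : j <= nO -> nth false w (nX + nT + 2 + j) = (j < nO).
Proof.
move=> ?; rewrite /encode -!cardE.
rewrite (_ : _ + j = (nX + (nT + j).+1).+1); last by lia.
by rewrite !nth_unary_skip nth_unary.
Qed.

Lemma nth_encode_tables j : nth false w (nX + nT + nO + 3 + j) = nth false
  ([seq x \in init S | x <- enum X]
   ++ [seq (xt.1, xt.2, y) \in trans S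
        | xt <- [seq (x, t) | x <- enum X, t <- enum (event S)], y <- enum X]
   ++ [seq label t == Some o | t <- enum (event S), o <- enum (output S)]) j.
Proof.
rewrite /encode -!cardE.
rewrite (_ : _ + j = (nX + (nT + (nO + j).+1).+1).+1); last by lia.
by rewrite !nth_unary_skip.
Qed.

Lemma nth_encode_init x :
  nth false w (nX + nT + nO + 3 + enum_rank x) = (x \in init S).
Proof.
rewrite nth_encode_tables nth_cat size_map -cardE ltn_ord.
by rewrite (nth_map x) -?cardE ?ltn_ord // nth_enum_rank.
Qed.

Lemma nth_encode_trans x t y :
  nth false w (nX + nT + nO + 3
    + (nX + (nX * (nT * enum_rank x + enum_rank t) + enum_rank y)))
  = ((x, t, y) \in trans S).
Proof.
have lt_xt : nT * enum_rank x + enum_rank t < nX * nT.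
  exact: ltn_mulD (ltn_ord _) (ltn_ord _).
have := ltn_ord (enum_rank y); set k := nT * _ + _ in lt_xt * => lt_y.
rewrite nth_encode_tables nth_cat size_map -cardE ltnNge leq_addr addKn.
rewrite nth_cat !size_allpairs -!cardE ifT; last exact: ltn_mulD.
rewrite [X in X * k]cardE (nth_allpairs _ (x, t) y) ?size_allpairs -?cardE //.
by rewrite /k [X in X * _]cardE (nth_allpairs _ x t) -?cardE ?ltn_ord // !nth_enum_rank.
Qed.

Lemma nth_encode_label t o :
  nth false w (nX + nT + nO + 3
    + (nX + (nX * (nX * nT) + (nO * enum_rank t + enum_rank o))))
  = (@label S t == Some o).
Proof.
rewrite nth_encode_tables nth_cat size_map -cardE ltnNge leq_addr addKn.
rewrite nth_cat !size_allpairs -!cardE [nX * nT * nX]mulnC ltnNge leq_addr addKn.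
by rewrite /= [X in X * _]cardE (nth_allpairs _ t o) -?cardE ?ltn_ord // !nth_enum_rank.
Qed.

Definition reads (m : nat -> nat) : Prop :=
  forall j, j < B -> m j = nth false w j.

(** The memory past the input holds the reachability table, so a read there is replaced by 0, in
    agreement with the default of [nth false]. *)
Definition Input e := If (Lt (Var 0) (Add e (Const 1))) (Const 0) (Read e).

Lemma eval_Input e r m : r 0 = B -> reads m ->
  eval (Input e) r m = nth false w (eval e r m).
Proof.
move=> r0 rm; rewrite /= r0 subn_eq0 addn1; case: leqP => [le_e|/rm //].
by rewrite nth_default.
Qed.

(* The input has a zero bit at one of the positions e, ..., e + r1, where r1 is
   the index of the surrounding sum in UnaryLength. *)
Definition ZeroSeen e := Sum 2
  (And (Not (Lt (Var 1) (Var 2))) (Not (Input (Add e (Var 2))))).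

Definition UnaryLength e := Sum 1 (Not (ZeroSeen e)).

(** The sum counts the [i] with no zero at offsets 0 to [i], which is the length of the leading
    block of ones. The case [j = n] of the last hypothesis is the terminating zero that stops the
    count. *)
Lemma eval_UnaryLength e r m n k : r 0 = B -> reads m -> k + n < B ->
  (forall i j, eval e (upd (upd r 1 i) 2 j) m = k) ->
  (forall j, j <= n -> nth false w (k + j) = (j < n)) ->
  eval (UnaryLength e) r m = n.
Proof.
move=> r0 rm ltkB Ee unary; rewrite -[RHS]muln1 -(@sum_nat_widen B); last by lia.
transitivity (\sum_(i < r 0) eval (Not (ZeroSeen e)) (upd r 1 i) m); first by [].
rewrite r0; apply: eq_bigr => i _; rewrite eval_Not; congr (if _ then _ else _).
apply: negb_inj; rewrite negbK holds_Sum -leqNgt.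
have bodyE j : holds (And (Not (Lt (Var 1) (Var 2))) (Not (Input (Add e (Var 2)))))
    (upd (upd r 1 i) 2 j) m = (j <= i) && ~~ nth false w (k + j).
  by rewrite holds_And !holds_Not holds_Lt -leqNgt /holds eval_Input //= Ee; case: nth.
have r0' : upd r 1 i 0 = B by [].
apply/existsP/idP => [[j]|le_ni].
  rewrite bodyE; apply: contraTT; rewrite -ltnNge => lt_in; rewrite negb_and negbK.
  by case: (leqP j i) => //= le_ji; rewrite unary; lia.
have ltnB : n < upd r 1 i 0 by rewrite r0'; lia.
by exists (Ordinal ltnB); rewrite bodyE /= le_ni unary ?ltnn.
Qed.

(** These are recomputed at each use. From outside they read register 0 only, so they can be nested
    although all of them bind registers 1 and 2. *)
Definition NX := UnaryLength (Const 0).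
Definition NT := UnaryLength (Add NX (Const 1)).
Definition NO := UnaryLength (Add (Add NX NT) (Const 2)).

Lemma eval_NX r m : r 0 = B -> reads m -> eval NX r m = nX.
Proof.
move=> r0 rm; apply: (@eval_UnaryLength _ r m nX 0 r0 rm _ _ nth_encode_states) => //.
by rewrite size_encode; lia.
Qed.

Lemma eval_NT r m : r 0 = B -> reads m -> eval NT r m = nT.
Proof.
move=> r0 rm; apply: (@eval_UnaryLength _ r m nT (nX + 1) r0 rm _ _
  nth_encode_events) => //.
  by rewrite size_encode; lia.
by move=> i j; rewrite eval_Add eval_NX.
Qed.

Lemma eval_NO r m : r 0 = B -> reads m -> eval NO r m = nO.
Proof.
move=> r0 rm; apply: (@eval_UnaryLength _ r m nO (nX + nT + 2) r0 rm _ _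
  nth_encode_outputs) => //.
  by rewrite size_encode; lia.
by move=> i j; rewrite !eval_Add eval_NX ?eval_NT.
Qed.

Definition TablesStart := Add (Add (Add NX NT) NO) (Const 3).

Lemma eval_TablesStart r m : r 0 = B -> reads m ->
  eval TablesStart r m = nX + nT + nO + 3.
Proof. by move=> r0 rm; rewrite !eval_Add eval_NX ?eval_NT ?eval_NO. Qed.

Lemma leX : nX <= B. Proof. rewrite size_encode; lia. Qed.
Lemma leT : nT <= B. Proof. rewrite size_encode; lia. Qed.
Lemma leO : nO <= B. Proof. rewrite size_encode; lia. Qed.

Definition InitE x := Input (Add TablesStart (Var x)).

(** Tables are stored row by row. Register 1 is the index of all products, hence the conditions
    [1 < x] and [1 < t] below. *)
Definition TransE x t y := Input (Add TablesStart
  (Add NX (Add (Mul 1 NX (Add (Mul 1 NT (Var x)) (Var t))) (Var y)))).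

Definition LabelE t o := Input (Add TablesStart
  (Add NX (Add (Mul 1 NX (Mul 1 NX NT)) (Add (Mul 1 NO (Var t)) (Var o))))).

Lemma holds_InitE r m x sx : r 0 = B -> reads m -> r x = enum_rank sx ->
  holds (InitE x) r m = (sx \in init S).
Proof.
move=> r0 rm rx; rewrite /holds eval_Input // eval_Add eval_TablesStart //=.
by rewrite rx nth_encode_init eqb0 negbK.
Qed.

Lemma holds_TransE r m x t y sx st sy : r 0 = B -> reads m ->
  1 < x -> 1 < t ->
  r x = enum_rank sx -> r t = enum_rank st -> r y = enum_rank sy ->
  holds (TransE x t y) r m = ((sx, st, sy) \in trans S).
Proof.
move=> r0 rm x_gt1 t_gt1 rx rt ry.
have Vx i : eval (Var x) (upd r 1 i) m = enum_rank sx by rewrite /= upd_neq //; lia.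
have Vt i : eval (Var t) (upd r 1 i) m = enum_rank st by rewrite /= upd_neq //; lia.
rewrite /holds eval_Input // eval_Add eval_TablesStart // eval_Add eval_NX // eval_Add.
rewrite (@eval_Mul _ _ _ r m nX (nT * enum_rank sx + enum_rank st)).
- by rewrite /= ry nth_encode_trans eqb0 negbK.
- by rewrite r0 leX.
- by move=> i; rewrite eval_NX.
move=> i; rewrite eval_Add Vt; congr (_ + _); apply: eval_Mul.
- by rewrite [upd _ _ _ _]r0 leT.
- by move=> j; rewrite eval_NT.
- by move=> j; rewrite /= !upd_neq //; lia.
Qed.

Lemma holds_LabelE r m t o st so : r 0 = B -> reads m -> 1 < t ->
  r t = enum_rank st -> r o = enum_rank so ->
  holds (LabelE t o) r m = (@label S st == Some so).
Proof.
move=> r0 rm t_gt1 rt ro.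
rewrite /holds eval_Input // eval_Add eval_TablesStart // eval_Add eval_NX // eval_Add.
rewrite (@eval_Mul _ NX _ r m nX (nX * nT)); first 1 last.
- by rewrite r0 leX.
- by move=> i; rewrite eval_NX.
- move=> i; apply: eval_Mul => [|j|j]; rewrite ?eval_NX ?eval_NT //.
  by rewrite [upd _ _ _ _]r0 leX.
rewrite eval_Add (@eval_Mul _ NO _ r m nO (enum_rank st)); first 1 last.
- by rewrite r0 leO.
- by move=> i; rewrite eval_NO.
- by move=> i; rewrite /= upd_neq //; lia.
by rewrite /= ro nth_encode_label eqb0 negbK.
Qed.

Lemma holds_ExState v e r m : 0 < v -> r 0 = B -> reads m ->
  holds (ExBelow v NX e) r m = [exists x : X, holds e (upd r v (enum_rank x)) m].
Proof.
move=> v_gt0 r0 rm; apply: holds_ExBelow => [|i]; first by rewrite r0 leX.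
by apply: eval_NX => //; rewrite upd_neq //; lia.
Qed.

Lemma holds_ExEvent v e r m : 0 < v -> r 0 = B -> reads m ->
  holds (ExBelow v NT e) r m =
    [exists t : event S, holds e (upd r v (enum_rank t)) m].
Proof.
move=> v_gt0 r0 rm; apply: holds_ExBelow => [|i]; first by rewrite r0 leT.
by apply: eval_NT => //; rewrite upd_neq //; lia.
Qed.

Lemma holds_ExOutput v e r m : 0 < v -> r 0 = B -> reads m ->
  holds (ExBelow v NO e) r m =
    [exists o : output S, holds e (upd r v (enum_rank o)) m].
Proof.
move=> v_gt0 r0 rm; apply: holds_ExBelow => [|i]; first by rewrite r0 leO.
by apply: eval_NO => //; rewrite upd_neq //; lia.
Qed.

(** The empty label is an all-zero row, so it is tested as the absence of an output. Registers below
    10 are kept for variables bound in such formulas, whence the conditions [9 < x] and the like. *)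
Definition SilentE x y :=
  ExBelow 2 NT (And (TransE x 2 y) (Not (ExBelow 3 NO (LabelE 2 3)))).

Definition JointE x1 x2 y1 y2 :=
  ExBelow 2 NT (ExBelow 3 NT (ExBelow 4 NO (And (And (TransE x1 2 y1)
    (TransE x2 3 y2)) (And (LabelE 2 4) (LabelE 3 4))))).

Definition MoveE x1 x2 y1 y2 :=
  Or (And (SilentE x1 y1) (Eq (Var x2) (Var y2)))
    (Or (And (Eq (Var x1) (Var y1)) (SilentE x2 y2)) (JointE x1 x2 y1 y2)).

Lemma holds_SilentE r m x y sx sy : r 0 = B -> reads m -> 9 < x -> 9 < y ->
  r x = enum_rank sx -> r y = enum_rank sy ->
  holds (SilentE x y) r m = @silent S sx sy.
Proof.
move=> r0 rm ltx lty rx ry; rewrite holds_ExEvent //; apply: eq_existsb => t.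
have r0' : upd r 2 (enum_rank t) 0 = B by [].
rewrite holds_And (holds_TransE (sx := sx) (st := t) (sy := sy)) //;
  try by rewrite ?upd_neq //; lia.
congr (_ && _); rewrite holds_Not holds_ExOutput //.
transitivity (~~ [exists o, @label S t == Some o]).
  by congr (~~ _); apply: eq_existsb => o; apply: holds_LabelE.
case: (label t) => [o|]; last by apply/existsP => -[].
by apply/negbTE; rewrite negbK; apply/existsP; exists o.
Qed.

Lemma holds_JointE r m x1 x2 y1 y2 p q : r 0 = B -> reads m ->
  9 < x1 -> 9 < x2 -> 9 < y1 -> 9 < y2 ->
  r x1 = enum_rank p.1 -> r x2 = enum_rank p.2 ->
  r y1 = enum_rank q.1 -> r y2 = enum_rank q.2 ->
  holds (JointE x1 x2 y1 y2) r m = @joint S p q.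
Proof.
move=> r0 rm *; rewrite holds_ExEvent //; apply: eq_existsb => t1.
rewrite holds_ExEvent //; apply: eq_existsb => t2.
rewrite holds_ExOutput //; apply: eq_existsb => o.
rewrite !holds_And.
rewrite (holds_TransE (sx := p.1) (st := t1) (sy := q.1)) //;
  try by rewrite ?upd_neq //; lia.
rewrite (holds_TransE (sx := p.2) (st := t2) (sy := q.2)) //;
  try by rewrite ?upd_neq //; lia.
by rewrite (holds_LabelE (st := t1) (so := o)) //
  (holds_LabelE (st := t2) (so := o)) // -!andbA.
Qed.

Lemma holds_EqVar (r m : nat -> nat) x y (sx sy : X) :
  r x = enum_rank sx -> r y = enum_rank sy ->
  holds (Eq (Var x) (Var y)) r m = (sx == sy).
Proof.
move=> rx ry; rewrite holds_Eq /= rx ry.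
by apply/eqP/eqP => [/val_inj/enum_rank_inj|->].
Qed.

Lemma holds_MoveE r m x1 x2 y1 y2 p q : r 0 = B -> reads m ->
  9 < x1 -> 9 < x2 -> 9 < y1 -> 9 < y2 ->
  r x1 = enum_rank p.1 -> r x2 = enum_rank p.2 ->
  r y1 = enum_rank q.1 -> r y2 = enum_rank q.2 ->
  holds (MoveE x1 x2 y1 y2) r m = @move S p q.
Proof.
move=> r0 rm ltx1 ltx2 lty1 lty2 rx1 rx2 ry1 ry2.
rewrite !holds_Or !holds_And (holds_JointE (p := p) (q := q)) //.
rewrite (holds_SilentE (sx := p.1) (sy := q.1)) //
  (holds_SilentE (sx := p.2) (sy := q.2)) //.
by rewrite (holds_EqVar _ rx1 ry1) (holds_EqVar _ rx2 ry2).
Qed.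

End Formulas.

(** * The reachability table *)

(** A rule for loops that only add facts: [G z] is never lost, [Q i] is established in round [i] and
    survives whatever preserves [G]. The conclusion has the form of the premise on the body, so the
    rule applies to nested loops. *)
Lemma foldl_iota_forall (T Z : Type) (G : Z -> T -> Prop) (f : T -> nat -> T)
    (Inv : T -> Prop) (Q : nat -> T -> Prop) n :
  (forall i a b, Q i a -> (forall z, G z a -> G z b) -> Q i b) ->
  (forall i a, i < n -> Inv a ->
    [/\ Inv (f a i), forall z, G z a -> G z (f a i) & Q i (f a i)]) ->
  forall a, Inv a ->
    [/\ Inv (foldl f a (iota 0 n)), forall z, G z a -> G z (foldl f a (iota 0 n))
      & forall i, i < n -> Q i (foldl f a (iota 0 n))].
Proof.
move=> Qmono body a Inv_a; elim: n body => [|n IHn] body //.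
have [|Inv_n G_n Q_n] := IHn; first by move=> i b ltin; apply: body; lia.
rewrite -addn1 iotaD foldl_cat /= add0n.
have [Inv_n1 G_n1 Q_n1] := body n _ (ltnSn n) Inv_n.
split=> // [z Gz|i]; first exact/G_n1/G_n.
rewrite addn1 ltnS leq_eqVlt => /predU1P[->|/Q_n Q_i]; first by [].
exact: Qmono Q_i _.
Qed.

Lemma foldl_iota_count (T : Type) (Inv : nat -> T -> Prop) (f : T -> nat -> T) c n :
  (forall k i a, Inv k a -> Inv (k + c) (f a i)) ->
  forall k a, Inv k a -> Inv (k + n * c) (foldl f a (iota 0 n)).
Proof.
move=> body; elim: n 0 => [|n IHn] i k a Inv_a /=; first by rewrite addn0.
by rewrite mulSn addnA; apply/IHn/body.
Qed.

Lemma digits_inj n a b a' b' : b < n -> b' < n -> n * a + b = n * a' + b' ->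
  a = a' /\ b = b'.
Proof.
move=> ltb ltb' E; have n_gt0 : 0 < n by lia.
have := congr1 (divn^~ n) E; have := congr1 (modn^~ n) E.
rewrite ![n * _]mulnC !modnMDl !divnMDl // !modn_small // !divn_small // !addn0.
by [].
Qed.

(* The table of reachability starts right after the input of length n. *)
Definition addr n i1 i2 j1 j2 := n + (n * (n * (n * i1 + i2) + j1) + j2).

Lemma addr_inj n i1 i2 j1 j2 i1' i2' j1' j2' :
  i2 < n -> j1 < n -> j2 < n -> i2' < n -> j1' < n -> j2' < n ->
  addr n i1 i2 j1 j2 = addr n i1' i2' j1' j2' ->
  [/\ i1 = i1', i2 = i2', j1 = j1' & j2 = j2'].
Proof.
move=> lti2 ltj1 ltj2 lti2' ltj1' ltj2' /addnI E.
have [{}E ->] := digits_inj ltj2 ltj2' E.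
have [{}E ->] := digits_inj ltj1 ltj1' E.
by have [-> ->] := digits_inj lti2 lti2' E.
Qed.

(** Horner's scheme: a [Sum 1] of a term free of register 1 multiplies it by the input length. *)
Definition AddrE v1 v2 v3 v4 := Add (Var 0) (Add (Sum 1 (Add (Sum 1
  (Add (Sum 1 (Var v1)) (Var v2))) (Var v3))) (Var v4)).

Lemma eval_AddrE r m v1 v2 v3 v4 : 1 < v1 -> 1 < v2 -> 1 < v3 -> 1 < v4 ->
  eval (AddrE v1 v2 v3 v4) r m = addr (r 0) (r v1) (r v2) (r v3) (r v4).
Proof.
have scale e r1 k : (forall i, eval e (upd r1 1 i) m = k) ->
    eval (Sum 1 e) r1 m = r1 0 * k.
  move=> Ek; transitivity (\sum_(i < r1 0) k); last by rewrite sum_nat_const card_ord.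
  by apply: eq_bigr => i _; apply: Ek.
move=> lt1 lt2 lt3 lt4; rewrite 2!eval_Add (scale _ _
  (r 0 * (r 0 * r v1 + r v2) + r v3)) //.
move=> i; rewrite eval_Add (scale _ _ (r 0 * r v1 + r v2)) => [|j].
  by rewrite /= !upd_neq //; lia.
rewrite eval_Add (scale _ _ (r v1)) => [|k].
  by rewrite /= !upd_neq //; lia.
by rewrite /= !upd_neq //; lia.
Qed.

Section Table.
Variable S : automaton.
Local Notation X := (state S).
Local Notation B := (size (encode S)).

Definition cell (m : nat -> nat) (p q : X * X) : bool :=
  m (addr B (enum_rank p.1) (enum_rank p.2) (enum_rank q.1) (enum_rank q.2)) != 0.

Definition ReachE v1 v2 v3 v4 := Read (AddrE v1 v2 v3 v4).

Lemma holds_ReachE (r m : nat -> nat) v1 v2 v3 v4 (p q : X * X) : r 0 = B ->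
  1 < v1 -> 1 < v2 -> 1 < v3 -> 1 < v4 ->
  r v1 = enum_rank p.1 -> r v2 = enum_rank p.2 ->
  r v3 = enum_rank q.1 -> r v4 = enum_rank q.2 ->
  holds (ReachE v1 v2 v3 v4) r m = cell m p q.
Proof.
move=> r0 lt1 lt2 lt3 lt4 E1 E2 E3 E4.
rewrite /holds (_ : eval _ r m = m (eval (AddrE v1 v2 v3 v4) r m)) //.
by rewrite eval_AddrE // r0 E1 E2 E3 E4.
Qed.

Definition ExPair v1 v2 e := ExBelow v1 NX (ExBelow v2 NX e).

Lemma holds_ExPair v1 v2 e r m : 0 < v1 -> 0 < v2 -> r 0 = B -> reads S m ->
  holds (ExPair v1 v2 e) r m =
  [exists p : X * X, holds e (upd (upd r v1 (enum_rank p.1)) v2 (enum_rank p.2)) m].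
Proof.
move=> v1_gt0 v2_gt0 r0 rm; rewrite (holds_ExState _ v1_gt0 r0 rm).
have r0' i : upd r v1 i 0 = B by rewrite upd_neq //; lia.
apply/existsP/existsP => [[x]|[[x y] ?]].
  by rewrite (holds_ExState _ v2_gt0 (r0' _) rm) => /existsP[y ?]; exists (x, y).
by exists x; rewrite (holds_ExState _ v2_gt0 (r0' _) rm); apply/existsP; exists y.
Qed.

(** The first disjunct keeps entries once set; the diagonal seeds the table, which starts out
    empty. *)
Definition StepE := Or (ReachE 10 11 12 13)
  (Or (And (Eq (Var 10) (Var 12)) (Eq (Var 11) (Var 13)))
    (ExPair 14 15 (And (ReachE 10 11 14 15) (MoveE 14 15 12 13)))).

Lemma holds_StepE (r m : nat -> nat) (p q : X * X) : r 0 = B -> reads S m ->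
  r 10 = enum_rank p.1 -> r 11 = enum_rank p.2 ->
  r 12 = enum_rank q.1 -> r 13 = enum_rank q.2 ->
  holds StepE r m = [|| cell m p q, p == q | [exists a, cell m p a && move a q]].
Proof.
move=> r0 rm E1 E2 E3 E4; rewrite !holds_Or (@holds_ReachE _ _ _ _ _ _ p q) //.
rewrite holds_And (holds_EqVar _ E1 E3) (holds_EqVar _ E2 E4) holds_ExPair //.
congr [|| _, _ | _]; apply: eq_existsb => a; rewrite holds_And.
by rewrite (@holds_ReachE _ _ _ _ _ _ p a) // (holds_MoveE (p := a) (q := q)).
Qed.

Definition RoundC :=
  For 10 (For 11 (For 12 (For 13 (Store (AddrE 10 11 12 13) StepE)))).

(** The outer loops count rounds: a simple path has fewer moves than there are pairs, and these
    number at most the square of the input length. *)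
Definition FillC := For 30 (For 31 RoundC).

(** Updates are made in place, so an entry may be set earlier than the number of rounds predicts;
    hence bounds from both sides instead of an exact description. *)
Record table_inv (n : nat) (m : nat -> nat) : Prop := TableInv {
  inv_reads : reads S m;
  inv_sound : forall p q, cell m p q -> connect (@move S) p q;
  inv_complete : forall p s, path (@move S) p s -> size s < n -> cell m p (last p s)
}.

(* The row and column of the entry being updated may lie outside the range of
   the states, in which case no cell changes. *)
Lemma store_inv n r m : r 0 = B ->
  r 10 < B -> r 11 < B -> r 12 < B -> r 13 < B -> table_inv n m ->
  let m' := den (Store (AddrE 10 11 12 13) StepE) r m in
  [/\ table_inv n m', forall p q, cell m p q -> cell m' p q
    & forall p s, path (@move S) p s -> size s < n.+1 ->
        (enum_rank p.1 : nat) = r 10 -> (enum_rank p.2 : nat) = r 11 ->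
        (enum_rank (last p s).1 : nat) = r 12 -> (enum_rank (last p s).2 : nat) = r 13 ->
        cell m' p (last p s)].
Proof.
move=> r0 lt10 lt11 lt12 lt13 [rm sound complete] m'.
have m'E : m' = upd m (addr B (r 10) (r 11) (r 12) (r 13)) (eval StepE r m).
  by rewrite /m' -r0 -(eval_AddrE r m).
have lt_rank (x : X) : enum_rank x < B by apply: leq_trans (ltn_ord _) (leX S).
(* Addresses are injective on digits below [B], so only the entry selected by registers 10 to 13 can
   change. *)
have cellE p q : cell m' p q =
    if [&& (enum_rank p.1 : nat) == r 10, (enum_rank p.2 : nat) == r 11,
           (enum_rank q.1 : nat) == r 12 & (enum_rank q.2 : nat) == r 13]
    then [|| cell m p q, p == q | [exists a, cell m p a && move a q]] else cell m p q.
  rewrite /cell m'E; case: and4P => [[/eqP E1 /eqP E2 /eqP E3 /eqP E4]|ne].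
    rewrite E1 E2 E3 E4 upd_eq -/(holds _ _ _).
    by rewrite (holds_StepE (p := p) (q := q)) // /cell E1 E2 E3 E4.
  rewrite upd_neq //; apply: contra_notN ne => /eqP E.
  have [-> -> -> ->] := addr_inj (lt_rank _) (lt_rank _) (lt_rank _) lt11 lt12 lt13 E.
  by [].
have mono p q : cell m p q -> cell m' p q.
  by rewrite cellE; case: ifP => // _ ->.
split=> // [|p s path_s lt_s E1 E2 E3 E4].
  split=> [j ltj|p q|p s path_s lt_s]; last exact/mono/complete.
    by rewrite m'E upd_neq ?rm // /addr; lia.
  rewrite cellE; case: ifP => _; last exact: sound.
  case/or3P=> [/sound//|/eqP->|/existsP[a /andP[/sound con mv]]]; first exact: connect0.
  exact: connect_trans con (connect1 mv).
rewrite cellE E1 E2 E3 E4 !eqxx /=.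
(* The diagonal disjunct covers the empty path; otherwise completeness at [n] covers the path
   without its last move. *)
case/lastP: s path_s lt_s {E3 E4} => [|s q]; first by rewrite eqxx orbT.
rewrite rcons_path size_rcons last_rcons ltnS => /andP[path_s mv] lt_s.
by apply/or3P/Or33/existsP; exists (last p s); rewrite mv complete.
Qed.

Lemma round_inv n r m : r 0 = B -> table_inv n m -> table_inv n.+1 (den RoundC r m).
Proof.
move=> r0 inv_m.
pose G (z : (X * X) * (X * X)) m1 := cell m1 z.1 z.2 : Prop.
(* [Q4] is completeness at [n.+1] for a single entry, and [Q3] to [Q1] close it over the loops;
   meanwhile the invariant stays [table_inv n]. *)
pose Q4 i1 i2 j1 j2 m1 := forall p s, path (@move S) p s -> size s < n.+1 ->
  (enum_rank p.1 : nat) = i1 -> (enum_rank p.2 : nat) = i2 ->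
  (enum_rank (last p s).1 : nat) = j1 -> (enum_rank (last p s).2 : nat) = j2 ->
  cell m1 p (last p s).
have Q4mono i1 i2 j1 j2 a b : Q4 i1 i2 j1 j2 a -> (forall z, G z a -> G z b) ->
    Q4 i1 i2 j1 j2 b.
  move=> Qa le_ab p s path_s lt_s E1 E2 E3 E4.
  by apply: (le_ab (p, last p s)); apply: Qa.
have lt_rank (x : X) : enum_rank x < B by apply: leq_trans (ltn_ord _) (leX S).
pose Q3 i1 i2 j1 m1 := forall j2, j2 < r 0 -> Q4 i1 i2 j1 j2 m1.
pose Q2 i1 i2 m1 := forall j1, j1 < r 0 -> Q3 i1 i2 j1 m1.
pose Q1 i1 m1 := forall i2, i2 < r 0 -> Q2 i1 i2 m1.
have [[rm sound complete] _ Qall] : [/\ table_inv n (den RoundC r m),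
    forall z, G z m -> G z (den RoundC r m)
  & forall i1, i1 < r 0 -> Q1 i1 (den RoundC r m)].
  apply: (@foldl_iota_forall _ _ G _ (table_inv n) Q1) inv_m => [i1 a b Qa le_ab|i1 a lt1].
    by move=> i2 lti2 j1 ltj1 j2 ltj2; apply: Q4mono le_ab; apply: Qa.
  apply: (@foldl_iota_forall _ _ G _ (table_inv n) (Q2 i1)) => [i2 b c Qb le_bc|i2 b lt2].
    by move=> j1 ltj1 j2 ltj2; apply: Q4mono le_bc; apply: Qb.
  apply: (@foldl_iota_forall _ _ G _ (table_inv n) (Q3 i1 i2)) => [j1 c d Qc le_cd|j1 c lt3].
    by move=> j2 ltj2; apply: Q4mono le_cd; apply: Qc.
  apply: (@foldl_iota_forall _ _ G _ (table_inv n) (Q4 i1 i2 j1)) => [j2 d e|j2 d lt4 inv_d].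
    exact: Q4mono.
  have lt_r0 k : k < r 0 -> k < B by rewrite r0.
  have [inv' mono' complete'] := @store_inv n
    (upd (upd (upd (upd r 10 i1) 11 i2) 12 j1) 13 j2) d r0
    (lt_r0 _ lt1) (lt_r0 _ lt2) (lt_r0 _ lt3) (lt_r0 _ lt4) inv_d.
  by split=> // z; apply: mono'.
rewrite -r0 in lt_rank.
split=> // p s path_s lt_s.
by apply: (Qall _ (lt_rank p.1) _ (lt_rank p.2) _ (lt_rank (last p s).1) _
  (lt_rank (last p s).2)).
Qed.

Lemma fill_inv r m : r 0 = B -> table_inv 0 m -> table_inv (B * B) (den FillC r m).
Proof.
move=> r0 inv_m; rewrite -[X in X * _]r0 -[_ * _]add0n.
apply: (@foldl_iota_count _ table_inv) inv_m => k i a inv_a.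
rewrite -[X in k + X]muln1 -[X in X * 1]r0.
apply: (@foldl_iota_count _ table_inv) inv_a => k' j b inv_b.
by rewrite addn1; apply: round_inv.
Qed.

Lemma table_cell m p q : table_inv (B * B) m -> cell m p q = connect (@move S) p q.
Proof.
case=> _ sound complete; apply/idP/idP => [/sound//|/connectP[s path_s ->]].
case/shortenP: path_s => s' path_s' uniq_s' _; apply: complete => //.
have := max_card (mem (p :: s')); rewrite (card_uniqP uniq_s') card_prod /= => lt_s.
by apply: leq_trans lt_s _; apply: leq_mul; apply: leX.
Qed.

(** * The ambiguity formula and the decision procedure *)

Definition PumpE v1 v2 := ExPair 20 21 (ExPair 22 23
  (And (ReachE v1 v2 20 21) (And (JointE 20 21 22 23) (ReachE 22 23 v1 v2)))).

(** Registers 10 to 17 here and 20 to 23 in [PumpE] are disjoint, which prevents capture. The pair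
    [(r.1, r.1)] is register 16 given twice. *)
Definition AmbiguousE := ExPair 10 11 (ExPair 12 13 (ExPair 14 15 (ExPair 16 17
  (And (InitE 10) (And (InitE 11) (And (ReachE 10 11 12 13) (And (PumpE 12 13)
  (And (ReachE 12 13 16 17) (And (Not (Eq (Var 16) (Var 17)))
  (And (ReachE 16 16 14 15) (PumpE 14 15))))))))))).

Lemma holds_PumpE r m v1 v2 (p : X * X) : r 0 = B -> table_inv (B * B) m ->
  9 < v1 < 20 -> 9 < v2 < 20 -> r v1 = enum_rank p.1 -> r v2 = enum_rank p.2 ->
  holds (PumpE v1 v2) r m = pumping p.
Proof.
move=> r0 inv_m lt1 lt2 E1 E2; have rm := inv_reads inv_m.
rewrite holds_ExPair //; apply: eq_existsb => a.
rewrite holds_ExPair //; apply: eq_existsb => b.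
set r' := upd _ _ _.
have E1' : r' v1 = enum_rank p.1 by rewrite /r' !upd_neq //; lia.
have E2' : r' v2 = enum_rank p.2 by rewrite /r' !upd_neq //; lia.
rewrite !holds_And (holds_JointE (p := a) (q := b)) //.
rewrite (@holds_ReachE _ _ _ _ _ _ p a) //; try by lia.
by rewrite (@holds_ReachE _ _ _ _ _ _ b p) // ?table_cell //; lia.
Qed.

Lemma holds_AmbiguousE r m : r 0 = B -> table_inv (B * B) m ->
  holds AmbiguousE r m = ambiguous S.
Proof.
move=> r0 inv_m; have rm := inv_reads inv_m.
rewrite holds_ExPair //; apply: eq_existsb => p0.
rewrite holds_ExPair //; apply: eq_existsb => p.
rewrite holds_ExPair //; apply: eq_existsb => q.
rewrite holds_ExPair //; apply: eq_existsb => c.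
rewrite !holds_And holds_Not (holds_InitE (sx := p0.1)) //
  (holds_InitE (sx := p0.2)) //.
rewrite (@holds_ReachE _ _ _ _ _ _ p0 p) // (@holds_ReachE _ _ _ _ _ _ p c) //.
rewrite (@holds_ReachE _ _ _ _ _ _ (c.1, c.1) q) //.
rewrite (@holds_PumpE _ _ _ _ p) // (@holds_PumpE _ _ _ _ q) //.
by rewrite (@holds_EqVar S _ _ _ _ c.1 c.2) // !table_cell.
Qed.

Lemma table_inv_init : table_inv 0 (Defs.mem (init_config (encode S))).
Proof.
split=> // p q.
by rewrite /cell /= nth_default // leq_addr.
Qed.

End Table.

Theorem theorem5 : decidable_in_polytime encode strongly_detectable.
Proof.
have [p pE] : is_poly (fun n => costc n FillC + cost n AmbiguousE + 2).
  apply: is_polyD (is_poly_const 2).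
  exact: is_polyD (is_poly_costc _) (is_poly_cost _).
(* Scratch space starts at 40, above the largest register named in the command or the formula, which
   is 31. *)
exists (program 40 FillC AmbiguousE), p => S.
set s := init_config (encode S).
exists (eval AmbiguousE (regs s) (den FillC (regs s) (Defs.mem s)) == 0); split.
  by rewrite -pE program_correct.
rewrite strongly_detectableP
  -(@holds_AmbiguousE S (regs s) (den FillC (regs s) (Defs.mem s))) //.
  by rewrite /holds negbK.
exact: fill_inv (@table_inv_init S).
Qed.
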